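(* Let $\mathbf{C}$ be a 2-category. The category $\mathrm{PsCat}(\mathbf{C})$, whose objects are the pseudo-categories in $\mathbf{C}$ and whose morphisms are the pseudo-functors in $\mathbf{C}$, is a 2-category when equipped with natural transformations as 2-cells, with vertical composition $\dot\theta\cdot\theta=(\dot\theta_0\cdot\theta_0,\dot\theta_1\cdot\theta_1)$ and horizontal composition $\theta'\circ\theta=(\theta'_0\circ\theta_0,\theta'_1\circ\theta_1)$.
   Context: Conventions. In a 2-category $\mathbf{C}$, $\circ$ (or juxtaposition) denotes composition of morphisms, horizontal composition of 2-cells and whiskering; $\cdot$ denotes vertical composition of 2-cells ($\beta\cdot\alpha$ means first $\alpha$, then $\beta$). All pullbacks mentioned are assumed to exist and are strict pullbacks in the 2-categorical sense (universal also for 2-cells), so that $\langle -,-\rangle$ denotes the induced morphism or 2-cell into a pullback. For $d,c:C_1\to C_0$, the pullback $C_1\times_{C_0}C_1$ has projections $\pi_1,\pi_2$ with $d\pi_1=c\pi_2$; similarly for triple and quadruple pullbacks. We write $f\times g$ (with or without subscript) for $\langle f\pi_1,g\pi_2\rangle$, etc. Pseudo-category. A pseudo-category in $\mathbf{C}$ is a system $C=(C_0,C_1,d,c,e,m,\alpha,\lambda,\rho)$ where $C_0,C_1$ are objects, $d,c:C_1\to C_0$, $e:C_0\to C_1$, $m:C_1\times_{C_0}C_1\to C_1$ are morphisms, and $\alpha:m(1_{C_1}\times_{C_0}m)\to m(m\times_{C_0}1_{C_1})$, $\lambda:m\langle ec,1_{C_1}\rangle\to 1_{C_1}$, $\rho:m\langle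 1_{C_1},ed\rangle\to 1_{C_1}$ are invertible 2-cells, such that - $de=1_{C_0}=ce$; $dm=d\pi_2$, $cm=c\pi_1$; - $d\circ\lambda=1_d=d\circ\rho$, $c\circ\lambda=1_c=c\circ\rho$; $d\circ\alpha=1_{d\pi_3}$, $c\circ\alpha=1_{c\pi_1}$; $\lambda\circ e=\rho\circ e$; - (pentagon) $(\alpha\circ(m\times 1\times 1))\cdot(\alpha\circ(1\times 1\times m))=(m\circ(\alpha\times 1))\cdot(\alpha\circ(1\times m\times 1))\cdot(m\circ(1\times\alpha))$; - (triangle) $(m\circ(\rho\times 1))\cdot(\alpha\circ(1\times\langle ec,1\rangle))=m\circ(1\times\lambda)$. The structure of a pseudo-category $C'$ is denoted by the same letters with primes. Pseudo-functor. A pseudo-functor $F:C\to C'$ is a system $F=(F_0,F_1,\mu^F,\varepsilon^F)$ with morphisms $F_0:C_0\to C_0'$, $F_1:C_1\to C_1'$ and invertible 2-cells $\mu=\mu^F:F_1m\to m'(F_1\times_{F_0}F_1)$, $\varepsilon=\varepsilon^F:F_1e\to e'F_0$ such that - $d'F_1=F_0d$, $c'F_1=F_0c$; $d'\circ\mu=1_{F_0d\pi_2}$, $c'\circ\mu=1_{F_0c\pi_1}$; $d'\circ\varepsilon=1_{F_0}=c'\circ\varepsilon$; - $(\alpha'\circ(F_1\times F_1\times F_1))\cdot(m'\circ(1_{F_1}\times\mu))\cdot(\mu\circ(1\times m))=(m'\circ(\mu\times 1_{F_1}))\cdot(\mu\circ(m\times 1))\cdot(F_1\circ\alpha)$; -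 $F_1\circ\rho=(\rho'\circ F_1)\cdot(m'\langle 1_{F_1},\varepsilon\circ d\rangle)\cdot(\mu\circ\langle 1,ed\rangle)$; - $F_1\circ\lambda=(\lambda'\circ F_1)\cdot(m'\langle\varepsilon\circ c,1_{F_1}\rangle)\cdot(\mu\circ\langle ec,1\rangle)$. The composite of $F:C\to C'$ and $G:C'\to C''$ is $GF=(G_0F_0,G_1F_1,(\mu^G\circ(F_1\times_{F_0}F_1))\cdot(G_1\circ\mu^F),(\varepsilon^G\circ F_0)\cdot(G_1\circ\varepsilon^F))$, and the identity pseudo-functor of $C$ is $(1_{C_0},1_{C_1},1_m,1_e)$. Natural transformation. For pseudo-functors $F,G:C\to C'$, a natural transformation $\theta:F\to G$ is a pair $\theta=(\theta_0,\theta_1)$ of 2-cells $\theta_0:F_0\to G_0$, $\theta_1:F_1\to G_1$ of $\mathbf{C}$ with $d'\circ\theta_1=\theta_0\circ d$, $c'\circ\theta_1=\theta_0\circ c$, and $\mu^G\cdot(\theta_1\circ m)=(m'\circ(\theta_1\times_{\theta_0}\theta_1))\cdot\mu^F$, $\ \varepsilon^G\cdot(\theta_1\circ e)=(e'\circ\theta_0)\cdot\varepsilon^F$. *)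

(* Defs.v *)
From Corelib Require Import ssreflect ssrfun ssrbool.

Set Implicit Arguments.
Unset Strict Implicit.
Unset Printing Implicit Defensive.

Declare Scope twocat_scope.
Delimit Scope twocat_scope with tc.
Local Open Scope twocat_scope.

(* An arrow of the graph R packed with its end points.  Equality of packed
   arrows compares 2-cells whose 1-cell boundaries are only propositionally
   equal. *)
Record arrow (T : Type) (R : T -> T -> Type) : Type :=
  Arrow { src : T; tgt : T; arr : R src tgt }.
Arguments Arrow {T R src tgt} arr.

(* Strict 2-categories: [comp1 g f] is g after f, [vcomp b a] is first a then
   b, and [hcomp b a] is a on the inside. *)
Record twocat_structure (ob : Type) (hom : ob -> ob -> Type)
    (cell : forall A B, hom A B -> hom A B -> Type) : Type := TwoCatStructure {
  id1 : forall A, hom A A;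
  comp1 : forall A B D, hom B D -> hom A B -> hom A D;
  id2 : forall A B (f : hom A B), cell A B f f;
  vcomp : forall A B (f g h : hom A B),
    cell A B g h -> cell A B f g -> cell A B f h;
  hcomp : forall A B D (f f' : hom A B) (g g' : hom B D),
    cell B D g g' -> cell A B f f' -> cell A D (comp1 g f) (comp1 g' f');
  comp1A : forall A B D E (h : hom D E) (g : hom B D) (f : hom A B),
    comp1 h (comp1 g f) = comp1 (comp1 h g) f;
  comp1_idl : forall A B (f : hom A B), comp1 (id1 B) f = f;
  comp1_idr : forall A B (f : hom A B), comp1 f (id1 A) = f;
  vcompA : forall A B (f g h k : hom A B)
    (c : cell A B h k) (b : cell A B g h) (a : cell A B f g),
    vcomp c (vcomp b a) = vcomp (vcomp c b) a;
  vcomp_idl : forall A B (f g : hom A B) (a : cell A B f g),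
    vcomp (id2 g) a = a;
  vcomp_idr : forall A B (f g : hom A B) (a : cell A B f g),
    vcomp a (id2 f) = a;
  hcomp_id2 : forall A B D (g : hom B D) (f : hom A B),
    hcomp (id2 g) (id2 f) = id2 (comp1 g f);
  interchange : forall A B D (f f' f'' : hom A B) (g g' g'' : hom B D)
    (b' : cell B D g' g'') (b : cell B D g g')
    (a' : cell A B f' f'') (a : cell A B f f'),
    hcomp (vcomp b' b) (vcomp a' a) = vcomp (hcomp b' a') (hcomp b a);
  hcompA : forall A B D E (f f' : hom A B) (g g' : hom B D) (h h' : hom D E)
    (c : cell D E h h') (b : cell B D g g') (a : cell A B f f'),
    Arrow (hcomp c (hcomp b a)) = Arrow (hcomp (hcomp c b) a);
  hcomp_idl : forall A B (f f' : hom A B) (a : cell A B f f'),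
    Arrow (hcomp (id2 (id1 B)) a) = Arrow a;
  hcomp_idr : forall A B (f f' : hom A B) (a : cell A B f f'),
    Arrow (hcomp a (id2 (id1 A))) = Arrow a
}.

Record twocat : Type := TwoCat {
  ob :> Type;
  hom : ob -> ob -> Type;
  cell : forall A B, hom A B -> hom A B -> Type;
  str : twocat_structure cell
}.
Arguments cell {t A B} f g.

Section Cells.
Context {K : twocat}.

Definition one (A : K) : hom A A := id1 (str K) A.
Definition comp {A B D : K} (g : hom B D) (f : hom A B) : hom A D :=
  comp1 (str K) g f.
Local Notation "g ∘ f" := (comp g f) (at level 40, left associativity).

Definition invertible {A B : K} {f g : hom A B} (a : cell f g) : Prop :=
  exists b : cell g f,
    vcomp (str K) b a = id2 (str K) f /\ vcomp (str K) a b = id2 (str K) g.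

Definition twocell (A B : K) : Type := arrow (@cell K A B).

Definition idc {A B : K} (f : hom A B) : twocell A B := Arrow (id2 (str K) f).
Definition hc {A B D : K} (b : twocell B D) (a : twocell A B) : twocell A D :=
  @Arrow _ (@cell K A D) (src b ∘ src a) (tgt b ∘ tgt a)
    (hcomp (str K) (arr b) (arr a)).
(* The proof e closes the gap between boundaries that are only propositionally
   equal. *)
Definition vc {A B : K} (b a : twocell A B) (e : tgt a = src b) : twocell A B :=
  Arrow (vcomp (str K) (arr b)
           (eq_rect (tgt a) (fun g => cell (src a) g) (arr a) (src b) e)).

Definition of_cell {A B : K} {f g : hom A B} (a : cell f g) : twocell A B :=
  Arrow a.
End Cells.
Arguments one {K} A.

Notation "g ∘ f" := (comp g f) (at level 40, left associativity) : twocat_scope.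
Notation "b ⋆ a" := (hc b a) (at level 40, left associativity) : twocat_scope.
Notation "f ◃ a" := (hc (idc f) a) (at level 39, right associativity) : twocat_scope.
Notation "a ▹ f" := (hc a (idc f)) (at level 38, left associativity) : twocat_scope.
Notation "b ·[ e ] a" := (@vc _ _ _ b a e)
  (at level 45, left associativity, format "b  ·[ e ]  a") : twocat_scope.

Section CellLemmas.
Context {K : twocat}.

Lemma compA {A B D E : K} (h : hom D E) (g : hom B D) (f : hom A B) :
  h ∘ (g ∘ f) = (h ∘ g) ∘ f.
Proof. exact: comp1A. Qed.

Lemma comp_onel {A B : K} (f : hom A B) : one B ∘ f = f.
Proof. exact: comp1_idl. Qed.

Lemma comp_oner {A B : K} (f : hom A B) : f ∘ one A = f.
Proof. exact: comp1_idr. Qed.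

Lemma hcA {A B D E : K} (c : twocell D E) (b : twocell B D) (a : twocell A B) :
  c ⋆ (b ⋆ a) = (c ⋆ b) ⋆ a.
Proof. exact: hcompA. Qed.

Lemma hc_idc {A B D : K} (g : hom B D) (f : hom A B) :
  idc g ⋆ idc f = idc (g ∘ f).
Proof. by rewrite /hc /= hcomp_id2. Qed.

Lemma src_eq {A B : K} {a b : twocell A B} : a = b -> src a = src b.
Proof. by move->. Qed.

Lemma tgt_eq {A B : K} {a b : twocell A B} : a = b -> tgt a = tgt b.
Proof. by move->. Qed.
End CellLemmas.

(* A strict pullback of f and g.  The 2-cells a and b in [pb_pair2] carry their
   boundaries, so the source and target of the induced 2-cell are the induced
   1-cells (see [src_pb_pair2], [tgt_pb_pair2]). *)
Record pullback (K : twocat) (A B Z : K) (f : hom A Z) (g : hom B Z) : Type :=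
Pullback {
  apex : K;
  pb1 : hom apex A;
  pb2 : hom apex B;
  pb_square : f ∘ pb1 = g ∘ pb2;
  pb_pair : forall X (h : hom X A) (k : hom X B), f ∘ h = g ∘ k -> hom X apex;
  pb1_pair : forall X (h : hom X A) (k : hom X B) (e : f ∘ h = g ∘ k),
    pb1 ∘ pb_pair e = h;
  pb2_pair : forall X (h : hom X A) (k : hom X B) (e : f ∘ h = g ∘ k),
    pb2 ∘ pb_pair e = k;
  pb_ext : forall X (u v : hom X apex),
    pb1 ∘ u = pb1 ∘ v -> pb2 ∘ u = pb2 ∘ v -> u = v;
  pb_pair2 : forall X (a : twocell X A) (b : twocell X B),
    f ◃ a = g ◃ b -> twocell X apex;
  pb1_pair2 : forall X (a : twocell X A) (b : twocell X B) (e : f ◃ a = g ◃ b),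
    pb1 ◃ pb_pair2 e = a;
  pb2_pair2 : forall X (a : twocell X A) (b : twocell X B) (e : f ◃ a = g ◃ b),
    pb2 ◃ pb_pair2 e = b;
  pb_ext2 : forall X (u v : twocell X apex),
    pb1 ◃ u = pb1 ◃ v -> pb2 ◃ u = pb2 ◃ v -> u = v
}.
Arguments pb_pair {K A B Z f g} p {X} h k e.
Arguments pb_pair2 {K A B Z f g} p {X} a b e.

(* A choice of a pullback for every cospan that has one: it only fixes what
   the notation for pullbacks denotes. *)
Definition pullback_choice (K : twocat) : Type :=
  forall (A B Z : K) (f : hom A Z) (g : hom B Z),
    inhabited (pullback f g) -> pullback f g.

Section PullbackLemmas.
Context {K : twocat} {A B Z : K} {f : hom A Z} {g : hom B Z}.
Variable P : pullback f g.

Lemma pb1_pairA X Y (h : hom X A) (k : hom X B) (e : f ∘ h = g ∘ k)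
    (x : hom Y X) : pb1 P ∘ (pb_pair P h k e ∘ x) = h ∘ x.
Proof. by rewrite compA pb1_pair. Qed.

Lemma pb2_pairA X Y (h : hom X A) (k : hom X B) (e : f ∘ h = g ∘ k)
    (x : hom Y X) : pb2 P ∘ (pb_pair P h k e ∘ x) = k ∘ x.
Proof. by rewrite compA pb2_pair. Qed.

Lemma pb_squareA X (x : hom X (apex P)) : f ∘ (pb1 P ∘ x) = g ∘ (pb2 P ∘ x).
Proof. by rewrite !compA pb_square. Qed.

Lemma src_pb_pair2 X (a : twocell X A) (b : twocell X B) (e : f ◃ a = g ◃ b) :
  src (pb_pair2 P a b e) = pb_pair P (src a) (src b) (src_eq e).
Proof.
apply: (pb_ext (p := P)); rewrite ?pb1_pair ?pb2_pair.
  exact: (src_eq (pb1_pair2 P e)).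
exact: (src_eq (pb2_pair2 P e)).
Qed.

Lemma tgt_pb_pair2 X (a : twocell X A) (b : twocell X B) (e : f ◃ a = g ◃ b) :
  tgt (pb_pair2 P a b e) = pb_pair P (tgt a) (tgt b) (tgt_eq e).
Proof.
apply: (pb_ext (p := P)); rewrite ?pb1_pair ?pb2_pair.
  exact: (tgt_eq (pb1_pair2 P e)).
exact: (tgt_eq (pb2_pair2 P e)).
Qed.
End PullbackLemmas.

Section Pseudocategories.
Context {K : twocat}.
Variable pb : pullback_choice K.

(* The triple and quadruple pullbacks are
   iterated binary ones: C3 = C1 x_C0 C2 and C4 = C1 x_C0 C3. *)
Record pregraph : Type := Pregraph {
  C0 : K;
  C1 : K;
  dom : hom C1 C0;
  cod : hom C1 C0;
  has2 : inhabited (pullback dom cod);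
  has3 : inhabited (pullback dom (cod ∘ pb1 (pb has2)));
  has4 : inhabited (pullback dom (cod ∘ pb1 (pb has3)));
  unit : hom C0 C1;
  mul : hom (apex (pb has2)) C1;
  dom_unit : dom ∘ unit = one C0;
  cod_unit : cod ∘ unit = one C0;
  dom_mul : dom ∘ mul = dom ∘ pb2 (pb has2);
  cod_mul : cod ∘ mul = cod ∘ pb1 (pb has2)
}.

Definition P2 (G : pregraph) := pb (has2 G).
Definition P3 (G : pregraph) := pb (has3 G).
Definition P4 (G : pregraph) := pb (has4 G).
Definition C2 (G : pregraph) : K := apex (P2 G).
Definition C3 (G : pregraph) : K := apex (P3 G).
Definition C4 (G : pregraph) : K := apex (P4 G).

Section Pregraph.
Context {G : pregraph}.
Local Notation d := (dom G).
Local Notation c := (cod G).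
Local Notation e := (unit G).
Local Notation m := (mul G).

Definition pi21 : hom (C2 G) (C1 G) := pb1 (P2 G).
Definition pi22 : hom (C2 G) (C1 G) := pb2 (P2 G).
Definition pi31 : hom (C3 G) (C1 G) := pb1 (P3 G).
Definition pi32 : hom (C3 G) (C1 G) := pi21 ∘ pb2 (P3 G).
Definition pi33 : hom (C3 G) (C1 G) := pi22 ∘ pb2 (P3 G).
Definition pi41 : hom (C4 G) (C1 G) := pb1 (P4 G).
Definition pi42 : hom (C4 G) (C1 G) := pi31 ∘ pb2 (P4 G).
Definition pi43 : hom (C4 G) (C1 G) := pi32 ∘ pb2 (P4 G).
Definition pi44 : hom (C4 G) (C1 G) := pi33 ∘ pb2 (P4 G).

Definition tup2 {X : K} (f g : hom X (C1 G)) (fg : d ∘ f = c ∘ g) :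
  hom X (C2 G) := pb_pair (P2 G) f g fg.

Lemma tup3_subproof {X : K} {f g h : hom X (C1 G)} (fg : d ∘ f = c ∘ g)
    (gh : d ∘ g = c ∘ h) : d ∘ f = (c ∘ pi21) ∘ tup2 gh.
Proof. by rewrite -compA pb1_pair. Qed.

Definition tup3 {X : K} (f g h : hom X (C1 G)) (fg : d ∘ f = c ∘ g)
    (gh : d ∘ g = c ∘ h) : hom X (C3 G) :=
  pb_pair (P3 G) f (tup2 gh) (tup3_subproof fg gh).

Lemma tup4_subproof {X : K} {f g h k : hom X (C1 G)} (fg : d ∘ f = c ∘ g)
    (gh : d ∘ g = c ∘ h) (hk : d ∘ h = c ∘ k) :
  d ∘ f = (c ∘ pi31) ∘ tup3 gh hk.
Proof. by rewrite -compA pb1_pair. Qed.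

Definition tup4 {X : K} (f g h k : hom X (C1 G)) (fg : d ∘ f = c ∘ g)
    (gh : d ∘ g = c ∘ h) (hk : d ∘ h = c ∘ k) : hom X (C4 G) :=
  pb_pair (P4 G) f (tup3 gh hk) (tup4_subproof fg gh hk).

Definition ctup2 {X : K} (a b : twocell X (C1 G)) (ab : d ◃ a = c ◃ b) :
  twocell X (C2 G) := pb_pair2 (P2 G) a b ab.

Section Equations.
Context {X : K}.

Lemma pi21_tup2 (f g : hom X (C1 G)) (fg : d ∘ f = c ∘ g) :
  pi21 ∘ tup2 fg = f.
Proof. exact: pb1_pair. Qed.

Lemma pi22_tup2 (f g : hom X (C1 G)) (fg : d ∘ f = c ∘ g) :
  pi22 ∘ tup2 fg = g.
Proof. exact: pb2_pair. Qed.

Lemma pi31_tup3 (f g h : hom X (C1 G)) (fg : d ∘ f = c ∘ g)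
  (gh : d ∘ g = c ∘ h) : pi31 ∘ tup3 fg gh = f.
Proof. exact: pb1_pair. Qed.

Lemma pi32_tup3 (f g h : hom X (C1 G)) (fg : d ∘ f = c ∘ g)
  (gh : d ∘ g = c ∘ h) : pi32 ∘ tup3 fg gh = g.
Proof. by rewrite -compA pb2_pair pi21_tup2. Qed.

Lemma pi33_tup3 (f g h : hom X (C1 G)) (fg : d ∘ f = c ∘ g)
  (gh : d ∘ g = c ∘ h) : pi33 ∘ tup3 fg gh = h.
Proof. by rewrite -compA pb2_pair pi22_tup2. Qed.

Lemma pi41_tup4 (f g h k : hom X (C1 G)) (fg : d ∘ f = c ∘ g)
  (gh : d ∘ g = c ∘ h) (hk : d ∘ h = c ∘ k) : pi41 ∘ tup4 fg gh hk = f.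
Proof. exact: pb1_pair. Qed.

Lemma pi42_tup4 (f g h k : hom X (C1 G)) (fg : d ∘ f = c ∘ g)
  (gh : d ∘ g = c ∘ h) (hk : d ∘ h = c ∘ k) : pi42 ∘ tup4 fg gh hk = g.
Proof. by rewrite -compA pb2_pair pi31_tup3. Qed.

Lemma pi43_tup4 (f g h k : hom X (C1 G)) (fg : d ∘ f = c ∘ g)
  (gh : d ∘ g = c ∘ h) (hk : d ∘ h = c ∘ k) : pi43 ∘ tup4 fg gh hk = h.
Proof. by rewrite -compA pb2_pair pi32_tup3. Qed.

Lemma pi44_tup4 (f g h k : hom X (C1 G)) (fg : d ∘ f = c ∘ g)
  (gh : d ∘ g = c ∘ h) (hk : d ∘ h = c ∘ k) : pi44 ∘ tup4 fg gh hk = k.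
Proof. by rewrite -compA pb2_pair pi33_tup3. Qed.

Lemma ext2 (u v : hom X (C2 G)) :
  pi21 ∘ u = pi21 ∘ v -> pi22 ∘ u = pi22 ∘ v -> u = v.
Proof. exact: pb_ext. Qed.

Lemma ext3 (u v : hom X (C3 G)) : pi31 ∘ u = pi31 ∘ v ->
  pi32 ∘ u = pi32 ∘ v -> pi33 ∘ u = pi33 ∘ v -> u = v.
Proof.
rewrite /pi32 /pi33 -!compA => e1 e2 e3.
by apply: (@pb_ext _ _ _ _ _ _ (P3 G) X u v) => //; apply: ext2.
Qed.

Lemma src_ctup2 (a b : twocell X (C1 G)) (ab : d ◃ a = c ◃ b) :
  src (ctup2 ab) = tup2 (src_eq ab).
Proof. exact: src_pb_pair2. Qed.

Lemma tgt_ctup2 (a b : twocell X (C1 G)) (ab : d ◃ a = c ◃ b) :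
  tgt (ctup2 ab) = tup2 (tgt_eq ab).
Proof. exact: tgt_pb_pair2. Qed.

Lemma pi21_ctup2 (a b : twocell X (C1 G)) (ab : d ◃ a = c ◃ b) :
  pi21 ◃ ctup2 ab = a.
Proof. exact: pb1_pair2. Qed.

Lemma pi22_ctup2 (a b : twocell X (C1 G)) (ab : d ◃ a = c ◃ b) :
  pi22 ◃ ctup2 ab = b.
Proof. exact: pb2_pair2. Qed.

Lemma square2 (u : hom X (C2 G)) : d ∘ (pi21 ∘ u) = c ∘ (pi22 ∘ u).
Proof. exact: pb_squareA. Qed.

Lemma dom_mulA (u : hom X (C2 G)) : d ∘ (m ∘ u) = d ∘ (pi22 ∘ u).
Proof. by rewrite !compA dom_mul. Qed.

Lemma cod_mulA (u : hom X (C2 G)) : c ∘ (m ∘ u) = c ∘ (pi21 ∘ u).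
Proof. by rewrite !compA cod_mul. Qed.

Lemma dom_unitA (u : hom X (C0 G)) : d ∘ (e ∘ u) = u.
Proof. by rewrite !compA dom_unit comp_onel. Qed.

Lemma cod_unitA (u : hom X (C0 G)) : c ∘ (e ∘ u) = u.
Proof. by rewrite !compA cod_unit comp_onel. Qed.
End Equations.

Lemma sq21 : d ∘ pi21 = c ∘ pi22.
Proof. exact: pb_square. Qed.

Lemma sq31 : d ∘ pi31 = c ∘ pi32.
Proof. by rewrite /pi32 compA; exact: pb_square. Qed.

Lemma sq32 : d ∘ pi32 = c ∘ pi33.
Proof. exact: square2. Qed.

Lemma sq41 : d ∘ pi41 = c ∘ pi42.
Proof. by rewrite /pi42 compA; exact: pb_square. Qed.

Lemma sq42 : d ∘ pi42 = c ∘ pi43.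
Proof.
rewrite /pi42 /pi43 (compA d pi31) (compA c pi32).
exact: (f_equal (fun u => u ∘ pb2 (P4 G)) sq31).
Qed.

Lemma sq43 : d ∘ pi43 = c ∘ pi44.
Proof.
rewrite /pi43 /pi44 (compA d pi32) (compA c pi33).
exact: (f_equal (fun u => u ∘ pb2 (P4 G)) sq32).
Qed.

Definition pi3_12 : hom (C3 G) (C2 G) := tup2 sq31.
Definition pi3_23 : hom (C3 G) (C2 G) := tup2 sq32.
Definition pi4_12 : hom (C4 G) (C2 G) := tup2 sq41.
Definition pi4_23 : hom (C4 G) (C2 G) := tup2 sq42.
Definition pi4_34 : hom (C4 G) (C2 G) := tup2 sq43.
Definition pi4_123 : hom (C4 G) (C3 G) := tup3 sq41 sq42.
Definition pi4_234 : hom (C4 G) (C3 G) := tup3 sq42 sq43.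

Lemma one_mul_subproof : d ∘ pi31 = c ∘ (m ∘ pi3_23).
Proof. by rewrite cod_mulA pi21_tup2 sq31. Qed.
Definition one_mul : hom (C3 G) (C2 G) := tup2 one_mul_subproof.

Lemma mul_one_subproof : d ∘ (m ∘ pi3_12) = c ∘ pi33.
Proof. by rewrite dom_mulA pi22_tup2 sq32. Qed.
Definition mul_one : hom (C3 G) (C2 G) := tup2 mul_one_subproof.

Lemma unit_l_subproof : d ∘ (e ∘ c) = c ∘ one (C1 G).
Proof. by rewrite dom_unitA comp_oner. Qed.
Definition unit_l : hom (C1 G) (C2 G) := tup2 unit_l_subproof.

Lemma unit_r_subproof : d ∘ one (C1 G) = c ∘ (e ∘ d).
Proof. by rewrite cod_unitA comp_oner. Qed.
Definition unit_r : hom (C1 G) (C2 G) := tup2 unit_r_subproof.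

Lemma mul_one_one_subproof : d ∘ (m ∘ pi4_12) = c ∘ pi43.
Proof. by rewrite dom_mulA pi22_tup2 sq42. Qed.
Definition mul_one_one : hom (C4 G) (C3 G) := tup3 mul_one_one_subproof sq43.

Lemma one_mul_one_subproof1 : d ∘ pi41 = c ∘ (m ∘ pi4_23).
Proof. by rewrite cod_mulA pi21_tup2 sq41. Qed.
Lemma one_mul_one_subproof2 : d ∘ (m ∘ pi4_23) = c ∘ pi44.
Proof. by rewrite dom_mulA pi22_tup2 sq43. Qed.
Definition one_mul_one : hom (C4 G) (C3 G) :=
  tup3 one_mul_one_subproof1 one_mul_one_subproof2.

Lemma one_one_mul_subproof : d ∘ pi42 = c ∘ (m ∘ pi4_34).
Proof. by rewrite cod_mulA pi21_tup2 sq42. Qed.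
Definition one_one_mul : hom (C4 G) (C3 G) := tup3 sq41 one_one_mul_subproof.

(* 1 x <ec, 1> *)
Lemma one_unit_l_subproof1 : d ∘ pi21 = c ∘ (e ∘ c ∘ pi22).
Proof. by rewrite -compA cod_unitA sq21. Qed.
Lemma one_unit_l_subproof2 : d ∘ (e ∘ c ∘ pi22) = c ∘ pi22.
Proof. by rewrite -compA dom_unitA. Qed.
Definition one_unit_l : hom (C2 G) (C3 G) :=
  tup3 one_unit_l_subproof1 one_unit_l_subproof2.
End Pregraph.

Record prepseudocat : Type := Prepseudocat {
  pc_graph :> pregraph;
  assoc : cell (mul pc_graph ∘ one_mul) (mul pc_graph ∘ mul_one);
  lunit : cell (mul pc_graph ∘ unit_l) (one (C1 pc_graph));
  runit : cell (mul pc_graph ∘ unit_r) (one (C1 pc_graph));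
  assoc_inv : invertible assoc;
  lunit_inv : invertible lunit;
  runit_inv : invertible runit;
  dom_lunit : dom pc_graph ◃ of_cell lunit = idc (dom pc_graph);
  dom_runit : dom pc_graph ◃ of_cell runit = idc (dom pc_graph);
  cod_lunit : cod pc_graph ◃ of_cell lunit = idc (cod pc_graph);
  cod_runit : cod pc_graph ◃ of_cell runit = idc (cod pc_graph);
  dom_assoc : dom pc_graph ◃ of_cell assoc = idc (dom pc_graph ∘ pi33);
  cod_assoc : cod pc_graph ◃ of_cell assoc = idc (cod pc_graph ∘ pi31);
  lunit_runit : of_cell lunit ▹ unit pc_graph = of_cell runit ▹ unit pc_graph
}.

Section Coherence.
Variable C : prepseudocat.
Local Notation d := (dom C).
Local Notation c := (cod C).
Local Notation e := (unit C).
Local Notation m := (mul C).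
Local Notation α := (of_cell (assoc C)).
Local Notation λ := (of_cell (lunit C)).
Local Notation ρ := (of_cell (runit C)).

Lemma assoc_one_subproof : d ◃ (α ▹ pi4_123) = c ◃ idc pi44.
Proof. by rewrite hcA dom_assoc !hc_idc -compA pi33_tup3 sq43. Qed.
Definition assoc_one : twocell (C4 C) (C2 C) := ctup2 assoc_one_subproof.

Lemma one_assoc_subproof : d ◃ idc pi41 = c ◃ (α ▹ pi4_234).
Proof. by rewrite hcA cod_assoc !hc_idc -compA pi31_tup3 sq41. Qed.
Definition one_assoc : twocell (C4 C) (C2 C) := ctup2 one_assoc_subproof.

Lemma runit_one_subproof : d ◃ (ρ ▹ pi21) = c ◃ idc pi22.
Proof. by rewrite hcA dom_runit !hc_idc sq21. Qed.
Definition runit_one : twocell (C2 C) (C2 C) := ctup2 runit_one_subproof.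

Lemma one_lunit_subproof : d ◃ idc pi21 = c ◃ (λ ▹ pi22).
Proof. by rewrite hcA cod_lunit !hc_idc sq21. Qed.
Definition one_lunit : twocell (C2 C) (C2 C) := ctup2 one_lunit_subproof.

Lemma pentagon_subproof1 : tgt (α ▹ one_one_mul) = src (α ▹ mul_one_one).
Proof.
rewrite /= -!compA; congr (_ ∘ _).
apply: ext2; rewrite !compA ?pi21_tup2 ?pi22_tup2.
  rewrite pi31_tup3 -compA; congr (_ ∘ _); apply: ext2.
    by rewrite compA ?pi21_tup2 pi31_tup3.
  by rewrite compA ?pi22_tup2 pi32_tup3.
rewrite pi33_tup3 -compA; congr (_ ∘ _); apply: ext2.
  by rewrite compA ?pi21_tup2 pi32_tup3.
by rewrite compA ?pi22_tup2 pi33_tup3.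
Qed.

Lemma pentagon_subproof2 : tgt (m ◃ one_assoc) = src (α ▹ one_mul_one).
Proof.
rewrite /= -!compA; congr (_ ∘ _).
rewrite tgt_ctup2; apply: ext2; rewrite !compA ?pi21_tup2 ?pi22_tup2 /=.
  by rewrite pi31_tup3.
rewrite -!compA; congr (_ ∘ _).
apply: ext2; rewrite !compA ?pi21_tup2 ?pi22_tup2.
  rewrite pi32_tup3 -compA; congr (_ ∘ _); apply: ext2.
    by rewrite compA ?pi21_tup2 pi31_tup3.
  by rewrite compA ?pi22_tup2 pi32_tup3.
by rewrite !pi33_tup3.
Qed.

Lemma pentagon_subproof3 : tgt (α ▹ one_mul_one) = src (m ◃ assoc_one).
Proof.
rewrite /= -!compA; congr (_ ∘ _).
rewrite src_ctup2; apply: ext2; rewrite !compA ?pi21_tup2 ?pi22_tup2 /=;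
  last by rewrite pi33_tup3.
rewrite -!compA; congr (_ ∘ _).
apply: ext2; rewrite !compA ?pi21_tup2 ?pi22_tup2.
  by rewrite !pi31_tup3.
rewrite pi32_tup3 -compA; congr (_ ∘ _); apply: ext2.
  by rewrite compA ?pi21_tup2 pi32_tup3.
by rewrite compA ?pi22_tup2 pi33_tup3.
Qed.

Lemma triangle_subproof : tgt (α ▹ one_unit_l) = src (m ◃ runit_one).
Proof.
rewrite /= -!compA; congr (_ ∘ _).
rewrite src_ctup2; apply: ext2; rewrite !compA ?pi21_tup2 ?pi22_tup2 /=;
  last by rewrite pi33_tup3.
rewrite -!compA; congr (_ ∘ _).
apply: ext2; rewrite !compA ?pi21_tup2 ?pi22_tup2.
  by rewrite pi31_tup3 comp_onel.
by rewrite pi32_tup3 -!compA sq21.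
Qed.
End Coherence.

Record pseudocategory : Type := Pseudocategory {
  pc_data :> prepseudocat;
  pentagon :
    (of_cell (assoc pc_data) ▹ mul_one_one)
      ·[pentagon_subproof1 pc_data] (of_cell (assoc pc_data) ▹ one_one_mul)
    = (mul pc_data ◃ assoc_one pc_data)
      ·[pentagon_subproof3 pc_data] (of_cell (assoc pc_data) ▹ one_mul_one)
      ·[pentagon_subproof2 pc_data] (mul pc_data ◃ one_assoc pc_data);
  triangle :
    (mul pc_data ◃ runit_one pc_data)
      ·[triangle_subproof pc_data] (of_cell (assoc pc_data) ▹ one_unit_l)
    = mul pc_data ◃ one_lunit pc_data
}.

Record prefunctor (C D : pseudocategory) : Type := Prefunctor {
  F0 : hom (C0 C) (C0 D);
  F1 : hom (C1 C) (C1 D);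
  dom_F1 : dom D ∘ F1 = F0 ∘ dom C;
  cod_F1 : cod D ∘ F1 = F0 ∘ cod C
}.

Section Prefunctor.
Context {C D : pseudocategory}.
Variable F : prefunctor C D.
Local Notation f0 := (F0 F).
Local Notation f1 := (F1 F).

Lemma dom_F1A X (u : hom X (C1 C)) : dom D ∘ (f1 ∘ u) = f0 ∘ (dom C ∘ u).
Proof. by rewrite !compA dom_F1. Qed.

Lemma cod_F1A X (u : hom X (C1 C)) : cod D ∘ (f1 ∘ u) = f0 ∘ (cod C ∘ u).
Proof. by rewrite !compA cod_F1. Qed.

Lemma F1_F1_subproof : dom D ∘ (f1 ∘ pi21) = cod D ∘ (f1 ∘ pi22).
Proof. by rewrite dom_F1A cod_F1A sq21. Qed.
Definition F1_F1 : hom (C2 C) (C2 D) := tup2 F1_F1_subproof.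

Lemma F1_F1_F1_subproof1 : dom D ∘ (f1 ∘ pi31) = cod D ∘ (f1 ∘ pi32).
Proof. by rewrite dom_F1A cod_F1A sq31. Qed.
Lemma F1_F1_F1_subproof2 : dom D ∘ (f1 ∘ pi32) = cod D ∘ (f1 ∘ pi33).
Proof. by rewrite dom_F1A cod_F1A sq32. Qed.
Definition F1_F1_F1 : hom (C3 C) (C3 D) :=
  tup3 F1_F1_F1_subproof1 F1_F1_F1_subproof2.
End Prefunctor.

Record prepseudofunctor (C D : pseudocategory) : Type := Prepseudofunctor {
  pf_1cells :> prefunctor C D;
  fmul : cell (F1 pf_1cells ∘ mul C) (mul D ∘ F1_F1 pf_1cells);
  funit : cell (F1 pf_1cells ∘ unit C) (unit D ∘ F0 pf_1cells);
  fmul_inv : invertible fmul;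
  funit_inv : invertible funit;
  dom_fmul : dom D ◃ of_cell fmul = idc (F0 pf_1cells ∘ dom C ∘ pi22);
  cod_fmul : cod D ◃ of_cell fmul = idc (F0 pf_1cells ∘ cod C ∘ pi21);
  dom_funit : dom D ◃ of_cell funit = idc (F0 pf_1cells);
  cod_funit : cod D ◃ of_cell funit = idc (F0 pf_1cells)
}.

Section FunctorCoherence.
Context {C D : pseudocategory}.
Variable F : prepseudofunctor C D.
Local Notation f0 := (F0 F).
Local Notation f1 := (F1 F).
Local Notation μ := (of_cell (fmul F)).
Local Notation ε := (of_cell (funit F)).

Lemma one_fmul_subproof :
  dom D ◃ idc (f1 ∘ pi31) = cod D ◃ (μ ▹ pi3_23).
Proof.
by rewrite hcA cod_fmul !hc_idc dom_F1A -!compA pi21_tup2 sq31.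
Qed.
(* 1_F1 x mu *)
Definition one_fmul : twocell (C3 C) (C2 D) := ctup2 one_fmul_subproof.

Lemma fmul_one_subproof :
  dom D ◃ (μ ▹ pi3_12) = cod D ◃ idc (f1 ∘ pi33).
Proof.
by rewrite hcA dom_fmul !hc_idc cod_F1A -!compA pi22_tup2 sq32.
Qed.
(* mu x 1_F1 *)
Definition fmul_one : twocell (C3 C) (C2 D) := ctup2 fmul_one_subproof.

Lemma one_funit_subproof : dom D ◃ idc f1 = cod D ◃ (ε ▹ dom C).
Proof. by rewrite hcA cod_funit !hc_idc dom_F1. Qed.
(* <1_F1, epsilon d> *)
Definition one_funit : twocell (C1 C) (C2 D) := ctup2 one_funit_subproof.

Lemma funit_one_subproof : dom D ◃ (ε ▹ cod C) = cod D ◃ idc f1.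
Proof. by rewrite hcA dom_funit !hc_idc cod_F1. Qed.
(* <epsilon c, 1_F1> *)
Definition funit_one : twocell (C1 C) (C2 D) := ctup2 funit_one_subproof.

Lemma fassoc_subproof1 : tgt (μ ▹ one_mul) = src (mul D ◃ one_fmul).
Proof.
rewrite /= -!compA; congr (_ ∘ _).
rewrite src_ctup2; apply: ext2; rewrite compA ?pi21_tup2 ?pi22_tup2 /=.
  by rewrite -compA pi21_tup2.
by rewrite -!compA pi22_tup2.
Qed.

Lemma fassoc_subproof2 :
  tgt (mul D ◃ one_fmul) = src (of_cell (assoc D) ▹ F1_F1_F1 F).
Proof.
rewrite /= -!compA; congr (_ ∘ _).
rewrite tgt_ctup2; apply: ext2; rewrite !compA ?pi21_tup2 ?pi22_tup2 /=.
  by rewrite pi31_tup3.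
rewrite -!compA; congr (_ ∘ _).
apply: ext2; rewrite !compA ?pi21_tup2 ?pi22_tup2.
  by rewrite pi32_tup3 -compA pi21_tup2.
by rewrite pi33_tup3 -compA pi22_tup2.
Qed.

Lemma fassoc_subproof3 : tgt (f1 ◃ of_cell (assoc C)) = src (μ ▹ mul_one).
Proof. exact: compA. Qed.

Lemma fassoc_subproof4 : tgt (μ ▹ mul_one) = src (mul D ◃ fmul_one).
Proof.
rewrite /= -!compA; congr (_ ∘ _).
rewrite src_ctup2; apply: ext2; rewrite compA ?pi21_tup2 ?pi22_tup2 /=.
  by rewrite -!compA pi21_tup2.
by rewrite -compA pi22_tup2.
Qed.

Lemma frunit_subproof1 : tgt (μ ▹ unit_r) = src (mul D ◃ one_funit).
Proof.
rewrite /= -!compA; congr (_ ∘ _).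
rewrite src_ctup2; apply: ext2; rewrite compA ?pi21_tup2 ?pi22_tup2 /=.
  by rewrite -compA pi21_tup2 comp_oner.
by rewrite -!compA pi22_tup2.
Qed.

Lemma frunit_subproof2 :
  tgt (mul D ◃ one_funit) = src (of_cell (runit D) ▹ f1).
Proof.
rewrite /= -!compA; congr (_ ∘ _).
rewrite tgt_ctup2; apply: ext2; rewrite compA ?pi21_tup2 ?pi22_tup2 /=.
  by rewrite comp_onel.
by rewrite -!compA dom_F1.
Qed.

Lemma flunit_subproof1 : tgt (μ ▹ unit_l) = src (mul D ◃ funit_one).
Proof.
rewrite /= -!compA; congr (_ ∘ _).
rewrite src_ctup2; apply: ext2; rewrite compA ?pi21_tup2 ?pi22_tup2 /=.
  by rewrite -!compA pi21_tup2.
by rewrite -compA pi22_tup2 comp_oner.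
Qed.

Lemma flunit_subproof2 :
  tgt (mul D ◃ funit_one) = src (of_cell (lunit D) ▹ f1).
Proof.
rewrite /= -!compA; congr (_ ∘ _).
rewrite tgt_ctup2; apply: ext2; rewrite compA ?pi21_tup2 ?pi22_tup2 /=.
  by rewrite -!compA cod_F1.
by rewrite comp_onel.
Qed.
End FunctorCoherence.

Record pseudofunctor (C D : pseudocategory) : Type := Pseudofunctor {
  pf_data :> prepseudofunctor C D;
  fmul_assoc :
    (of_cell (assoc D) ▹ F1_F1_F1 pf_data)
      ·[fassoc_subproof2 pf_data] (mul D ◃ one_fmul pf_data)
      ·[fassoc_subproof1 pf_data] (of_cell (fmul pf_data) ▹ one_mul)
    = (mul D ◃ fmul_one pf_data)
      ·[fassoc_subproof4 pf_data] (of_cell (fmul pf_data) ▹ mul_one)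
      ·[fassoc_subproof3 pf_data] (F1 pf_data ◃ of_cell (assoc C));
  fmul_runit :
    F1 pf_data ◃ of_cell (runit C)
    = (of_cell (runit D) ▹ F1 pf_data)
      ·[frunit_subproof2 pf_data] (mul D ◃ one_funit pf_data)
      ·[frunit_subproof1 pf_data] (of_cell (fmul pf_data) ▹ unit_r);
  fmul_lunit :
    F1 pf_data ◃ of_cell (lunit C)
    = (of_cell (lunit D) ▹ F1 pf_data)
      ·[flunit_subproof2 pf_data] (mul D ◃ funit_one pf_data)
      ·[flunit_subproof1 pf_data] (of_cell (fmul pf_data) ▹ unit_l)
}.

Section NaturalTransformations.
Context {C D : pseudocategory} {F G : pseudofunctor C D}.
Context {t0 : cell (F0 F) (F0 G)} {t1 : cell (F1 F) (F1 G)}.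
Hypothesis dom_t1 : dom D ◃ of_cell t1 = of_cell t0 ▹ dom C.
Hypothesis cod_t1 : cod D ◃ of_cell t1 = of_cell t0 ▹ cod C.

Lemma nt1_nt1_subproof :
  dom D ◃ (of_cell t1 ▹ pi21) = cod D ◃ (of_cell t1 ▹ pi22).
Proof. by rewrite !hcA dom_t1 cod_t1 -!hcA !hc_idc sq21. Qed.
Definition nt1_nt1 : twocell (C2 C) (C2 D) := ctup2 nt1_nt1_subproof.

Lemma nt_mul_subproof : tgt (of_cell (fmul F)) = src (mul D ◃ nt1_nt1).
Proof.
rewrite /=; congr (_ ∘ _).
by rewrite src_ctup2; apply: ext2; rewrite ?pi21_tup2 ?pi22_tup2.
Qed.
End NaturalTransformations.

Record nattrans (C D : pseudocategory) (F G : pseudofunctor C D) : Type :=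
Nattrans {
  nt0 : cell (F0 F) (F0 G);
  nt1 : cell (F1 F) (F1 G);
  dom_nt1 : dom D ◃ of_cell nt1 = of_cell nt0 ▹ dom C;
  cod_nt1 : cod D ◃ of_cell nt1 = of_cell nt0 ▹ cod C;
  nt_mul :
    of_cell (fmul G) ·[erefl] (of_cell nt1 ▹ mul C)
    = (mul D ◃ nt1_nt1 dom_nt1 cod_nt1)
      ·[nt_mul_subproof dom_nt1 cod_nt1] of_cell (fmul F);
  nt_unit :
    of_cell (funit G) ·[erefl] (of_cell nt1 ▹ unit C)
    = (unit D ◃ of_cell nt0) ·[erefl] of_cell (funit F)
}.

Definition is_identity (C : pseudocategory) (I : pseudofunctor C C) : Prop :=
  [/\ F0 I = one (C0 C), F1 I = one (C1 C),
      of_cell (fmul I) = idc (mul C) & of_cell (funit I) = idc (unit C)].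

Section Composite.
Context {C D E : pseudocategory}.
Variables (G : pseudofunctor D E) (F : pseudofunctor C D).

Lemma comp_fmul_subproof :
  tgt (F1 G ◃ of_cell (fmul F)) = src (of_cell (fmul G) ▹ F1_F1 F).
Proof. exact: compA. Qed.

Lemma comp_funit_subproof :
  tgt (F1 G ◃ of_cell (funit F)) = src (of_cell (funit G) ▹ F0 F).
Proof. exact: compA. Qed.

Definition is_composite (H : pseudofunctor C E) : Prop :=
  [/\ F0 H = F0 G ∘ F0 F, F1 H = F1 G ∘ F1 F,
      of_cell (fmul H) = (of_cell (fmul G) ▹ F1_F1 F)
        ·[comp_fmul_subproof] (F1 G ◃ of_cell (fmul F))
    & of_cell (funit H) = (of_cell (funit G) ▹ F0 F)
        ·[comp_funit_subproof] (F1 G ◃ of_cell (funit F))].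
End Composite.

End Pseudocategories.

(* Main.v *)
From Corelib Require Import ssreflect ssrfun ssrbool.
From Stdlib Require Import FunctionalExtensionality PropExtensionality.
From Stdlib Require Import ProofIrrelevance.
Require Import Defs.

Set Implicit Arguments.
Unset Strict Implicit.
Unset Printing Implicit Defensive.
Local Open Scope twocat_scope.

(** The 2-cells and the operations on them are computed in the ambient
    2-category, so every law that involves only the components of natural
    transformations (unit, associativity and interchange laws) is inherited from
    it.  What has to be shown is that the prescribed composites are again
    pseudo-functors and natural transformations, and that composition of
    pseudo-functors is strictly associative and unital.

    - Composition of pseudo-functors.  The coherence diagram of a composite GF
      is obtained by pasting the diagram of G whiskered with F and G applied to
      the diagram of F.  The two are glued along a naturality square, an instance
      of the interchange law that slides the structure 2-cell of G past a 2-cell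
      induced by the structure of F ([fmul_slide]).  The pasting itself is
      formal: [paste_assoc] for the associativity constraint and [paste_unit] for
      the two unit constraints.
    - Horizontal composition of natural transformations.  The compatibility
      square of t' ⋆ t is the square of t multiplied by t' followed by the square
      of t' multiplied by t ([hc_square_l], [hc_square_r]).
    - A 2-cell into the pullback C2 is determined by its two projections.  Hence
      the induced 2-cells, such as 1 x mu or theta1 x theta1, of a composite
      decompose into those of the factors, because their components do
      ([single_ext2]).

    The boundaries of the 2-cells that are composed here agree only up to
    propositional equality, and a vertical composite [b ·[e] a] carries a proof
    [e] that blocks rewriting inside it.  To calculate freely, a 2-cell [a] is
    replaced with the singleton [⟦a⟧], and vertical composition with the complex
    product [⊙] on sets of 2-cells: S ⊙ T consists of all composites
    that exist.  This product is total and associative without side conditions,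
    and [⟦b ·[e] a⟧ = ⟦b⟧ ⊙ ⟦a⟧], so an equation of pasted 2-cells can be proved
    between the associated sets.  Composability of [b] and [a] can even be
    recovered from an equation [⟦c⟧ = ⟦b⟧ ⊙ ⟦a⟧], as the right-hand side is then
    nonempty ([single_prod]). *)

(** * Vertical composition as a total operation *)

Section Cells.
Context {K : twocat} {A B : K}.
Implicit Types (x y a b c : twocell A B) (f g h : hom A B).

(** The transport of a 2-cell to boundaries that are propositionally equal to
    its own; it is how a 2-cell with computed boundary becomes a component of a
    structure that prescribes the boundary. *)
Definition recell f g x (es : src x = f) (et : tgt x = g) : cell f g :=
  eq_rect (tgt x) (cell f)
    (eq_rect (src x) (fun s => cell s (tgt x)) (arr x) f es) g et.

Lemma recellK f g x (es : src x = f) (et : tgt x = g) :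
  of_cell (recell es et) = x.
Proof. by case: x es et => s t x /= es et; case: g / et; case: f / es. Qed.

(** Packing loses nothing: an equality of packed 2-cells between the same
    1-cells induces loops on these 1-cells, and such loops are trivial by proof
    irrelevance. *)
Lemma of_cell_inj f g (a b : cell f g) : of_cell a = of_cell b -> a = b.
Proof.
have gen x y es et es' et' : x = y -> @recell f g x es et = @recell f g y es' et'.
  by move=> exy; subst y; rewrite (proof_irrelevance _ es' es)
    (proof_irrelevance _ et' et).
exact: (gen (of_cell a) (of_cell b) erefl erefl erefl erefl).
Qed.

Lemma recell_inv f g x (es : src x = f) (et : tgt x = g) :
  invertible (arr x) -> invertible (recell es et).
Proof. by case: x es et => s t x /= es et; case: g / et; case: f / es. Qed.

(** The same proofs serve on both sides, because the boundary of a composite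
    computes to the outer boundaries of its factors. *)
Lemma vcA c b a (e1 : tgt b = src c) (e2 : tgt a = src b) :
  @vc K A B c (b ·[e2] a) e1 = @vc K A B (c ·[e1] b) a e2.
Proof.
case: c b a e1 e2 => [s3 t3 c] [s2 t2 b] [s1 t1 a] /= e1 e2.
by subst s3 s2; rewrite /vc /= vcompA.
Qed.

Lemma vc_idl a f (e : tgt a = f) : idc f ·[e] a = a.
Proof. by case: a e => s t a /= e; subst f; rewrite /vc /= vcomp_idl. Qed.

Lemma vc_idr b f (e : f = src b) : b ·[e] idc f = b.
Proof. by case: b e => s t b /= e; subst f; rewrite /vc /= vcomp_idr. Qed.

Lemma vc_inv b a (e : tgt a = src b) :
  invertible (arr a) -> invertible (arr b) -> invertible (arr (b ·[e] a)).
Proof.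
case: b a e => [s2 t2 b] [s1 t1 a] /= e; subst s2.
move=> [a' [ea ea']] [b' [eb eb']]; exists (vcomp (str K) a' b') => /=; split.
  by rewrite -vcompA (vcompA (str K) b') eb vcomp_idl ea.
by rewrite -vcompA (vcompA (str K) a) ea' vcomp_idl eb'.
Qed.

Lemma idc_inv f : invertible (arr (idc f)).
Proof. by exists (id2 (str K) f); rewrite /= vcomp_idl. Qed.

Definition cellset : Type := twocell A B -> Prop.
Definition single a : cellset := eq a.
Definition cprod (S T : cellset) : cellset := fun c =>
  exists b a (e : tgt a = src b), [/\ S b, T a & c = b ·[e] a].

Lemma cellset_ext (S T : cellset) : (forall a, S a <-> T a) -> S = T.
Proof.
move=> ST; apply: functional_extensionality => a.
exact/propositional_extensionality/ST.
Qed.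

Lemma single_inj a b : single a = single b -> a = b.
Proof. by move=> eab; have: single b b by []; rewrite -eab. Qed.

Lemma cprodA (S T U : cellset) :
  cprod S (cprod T U) = cprod (cprod S T) U.
Proof.
apply: cellset_ext => x; split.
  move=> [c [ba [e1 [Sc [b [a [e2 [Tb Ua eba]]]] ->]]]]; subst ba.
  rewrite vcA.
  by exists (@vc _ _ _ c b e1), a, e2; split=> //; first by exists c, b, e1.
move=> [cb [a [e2 [[c [b [e1 [Sc Tb ecb]]]] Ua ->]]]]; subst cb.
rewrite -vcA.
by exists c, (@vc _ _ _ b a e2), e1; split=> //; first by exists b, a, e2.
Qed.

Lemma single_vc b a (e : tgt a = src b) :
  single (b ·[e] a) = cprod (single b) (single a).
Proof.
apply: cellset_ext => x; split; first by move=> <-; exists b, a, e.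
move=> [b' [a' [e' [eb ea ->]]]]; rewrite /single in eb ea; subst b' a'.
by rewrite (proof_irrelevance _ e e').
Qed.

Lemma single_idl a f : tgt a = f -> cprod (single (idc f)) (single a) = single a.
Proof. by move=> e; rewrite -(@single_vc (idc f) a e) vc_idl. Qed.

Lemma single_idr b f : f = src b -> cprod (single b) (single (idc f)) = single b.
Proof. by move=> e; rewrite -(@single_vc b (idc f) e) vc_idr. Qed.

(** A singleton is inhabited, so a product that equals one consists of a pair
    that is composable. *)
Lemma single_prod a b c : single c = cprod (single b) (single a) ->
  exists e : tgt a = src b, c = b ·[e] a.
Proof.
move=> ec; have: single c c by [].
rewrite ec => -[b' [a' [e [eb ea ->]]]]; rewrite /single in eb ea.
by subst b' a'; exists e.
Qed.
End Cells.

Arguments cellset {K} A B.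
Notation "⟦ a ⟧" := (single a) (at level 0, a at level 99, format "⟦ a ⟧").
Notation "S ⊙ T" := (cprod S T) (at level 45, left associativity).

(** * Whiskering, interchange and pasting *)

Section Whiskering.
Context {K : twocat} {A B D : K}.

(** The interchange law.  In [⟦b' ⋆ a'⟧ ⊙ ⟦b ⋆ a⟧] composability of the two
    horizontal composites does not imply that of the factors; the hypotheses
    provide it. *)
Lemma single_hc (b b' b'' : twocell B D) (a a' a'' : twocell A B) :
  ⟦b''⟧ = ⟦b'⟧ ⊙ ⟦b⟧ -> ⟦a''⟧ = ⟦a'⟧ ⊙ ⟦a⟧ ->
  ⟦b'' ⋆ a''⟧ = ⟦b' ⋆ a'⟧ ⊙ ⟦b ⋆ a⟧.
Proof.
move=> /single_prod[eb ->] /single_prod[ea ->].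
have e : tgt (b ⋆ a) = src (b' ⋆ a') by rewrite /= eb ea.
rewrite -(single_vc e); congr (single _).
case: b b' eb a a' ea e => [s1 t1 b] [s2 t2 b'] /= eb.
move=> [u1 v1 a] [u2 v2 a'] /= ea; subst s2 u2 => e.
by rewrite (proof_irrelevance _ e erefl) /hc /vc /= interchange.
Qed.

Lemma single_lw (g : hom B D) (b a : twocell A B) (e : tgt a = src b) :
  ⟦g ◃ (b ·[e] a)⟧ = ⟦g ◃ b⟧ ⊙ ⟦g ◃ a⟧.
Proof. by apply: single_hc; rewrite ?single_vc ?single_idl. Qed.

Lemma single_rw (f : hom A B) (b a : twocell B D) (e : tgt a = src b) :
  ⟦(b ·[e] a) ▹ f⟧ = ⟦b ▹ f⟧ ⊙ ⟦a ▹ f⟧.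
Proof. by apply: single_hc; rewrite ?single_vc ?single_idl. Qed.

(** Both sides are the horizontal composite [b ⋆ a]. *)
Lemma single_slide (b : twocell B D) (a : twocell A B) :
  ⟦tgt b ◃ a⟧ ⊙ ⟦b ▹ src a⟧ = ⟦b ▹ tgt a⟧ ⊙ ⟦src b ◃ a⟧.
Proof.
transitivity ⟦b ⋆ a⟧.
  by symmetry; apply: single_hc; rewrite ?single_idl ?single_idr.
by apply: single_hc; rewrite ?single_idl ?single_idr.
Qed.

Lemma lw_inv (g : hom B D) (a : twocell A B) :
  invertible (arr a) -> invertible (arr (g ◃ a)).
Proof.
case: a => s t a /= [a' [e e']]; exists (hcomp (str K) (id2 (str K) g) a').
by rewrite -!interchange e e' !vcomp_idl !hcomp_id2.
Qed.

Lemma rw_inv (f : hom A B) (b : twocell B D) :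
  invertible (arr b) -> invertible (arr (b ▹ f)).
Proof.
case: b => s t b /= [b' [e e']]; exists (hcomp (str K) b' (id2 (str K) f)).
by rewrite -!interchange e e' !vcomp_idl !hcomp_id2.
Qed.

Lemma lw_lw {E : K} (h : hom D E) (g : hom B D) (a : twocell A B) :
  h ◃ g ◃ a = (h ∘ g) ◃ a.
Proof. by rewrite hcA hc_idc. Qed.

Lemma rw_rw {E : K} (c : twocell D E) (g : hom B D) (f : hom A B) :
  c ▹ g ▹ f = c ▹ (g ∘ f).
Proof. by rewrite -hcA hc_idc. Qed.

Lemma lw_rw {E : K} (g : hom D E) (a : twocell B D) (f : hom A B) :
  g ◃ (a ▹ f) = (g ◃ a) ▹ f.
Proof. exact: hcA. Qed.

Lemma lw_one (a : twocell A B) : one B ◃ a = a.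
Proof. by case: a => s t a; exact: hcomp_idl. Qed.

Lemma rw_one (a : twocell A B) : a ▹ one A = a.
Proof. by case: a => s t a; exact: hcomp_idr. Qed.
End Whiskering.

Section Pasting.
Context {K : twocat}.

Lemma single_lw_prod {A B D : K} (g : hom B D) (a b c : twocell A B) :
  ⟦c⟧ = ⟦b⟧ ⊙ ⟦a⟧ -> ⟦g ◃ c⟧ = ⟦g ◃ b⟧ ⊙ ⟦g ◃ a⟧.
Proof. by move=> /single_prod[e ->]; exact: single_lw. Qed.

Lemma single_rw_prod {A B D : K} (f : hom A B) (a b c : twocell B D) :
  ⟦c⟧ = ⟦b⟧ ⊙ ⟦a⟧ -> ⟦c ▹ f⟧ = ⟦b ▹ f⟧ ⊙ ⟦a ▹ f⟧.
Proof. by move=> /single_prod[e ->]; exact: single_rw. Qed.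

(** Multiplying a commutative square on the left with a 2-cell [b] is
    horizontal composition with [b] = [tgt b] · [b] = [b] · [src b]; the two
    factorizations of [b] are used on the two sides of the square. *)
Lemma hc_square_l {A B D : K} (b : twocell B D) (x y x' y' : twocell A B)
    (e : tgt y = src x) (e' : tgt y' = src x') :
  x ·[e] y = x' ·[e'] y' ->
  ⟦tgt b ◃ x⟧ ⊙ ⟦b ⋆ y⟧ = ⟦b ⋆ x'⟧ ⊙ ⟦src b ◃ y'⟧.
Proof.
move=> sq; transitivity ⟦b ⋆ (x ·[e] y)⟧; last rewrite sq; [symmetry|];
  by apply: single_hc; rewrite ?single_vc ?single_idl ?single_idr.
Qed.

Lemma hc_square_r {A B D : K} (a : twocell A B) (x y x' y' : twocell B D)
    (e : tgt y = src x) (e' : tgt y' = src x') :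
  x ·[e] y = x' ·[e'] y' ->
  ⟦x ▹ tgt a⟧ ⊙ ⟦y ⋆ a⟧ = ⟦x' ⋆ a⟧ ⊙ ⟦y' ▹ src a⟧.
Proof.
move=> sq; transitivity ⟦(x ·[e] y) ⋆ a⟧; last rewrite sq; [symmetry|];
  by apply: single_hc; rewrite ?single_vc ?single_idl ?single_idr.
Qed.

(** The unit diagram of a composite GF: [d = r ⊙ b ⊙ c] is the diagram of G after
    F, [q = d ⊙ e ⊙ f] is G applied to the diagram of F, and [s ⊙ t = c ⊙ e] is the
    naturality square between them. *)
Lemma paste_unit {A B : K} (q b c d e f r s t : cellset A B) :
  s ⊙ t = c ⊙ e -> d = r ⊙ b ⊙ c -> q = d ⊙ e ⊙ f ->
  q = r ⊙ (b ⊙ s) ⊙ (t ⊙ f).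
Proof.
move=> st -> ->.
by rewrite -!cprodA (cprodA s t) st -!cprodA.
Qed.

(** The associativity diagram of a composite GF: the hexagon of G after F and G
    applied to the hexagon of F share the edge [d], the image under G of the
    associator in the middle, and each side of the result crosses one naturality
    square. *)
Lemma paste_assoc {A B : K} (a a' b b' c d d' e e' f f' s s' t t' : cellset A B) :
  s ⊙ t = c ⊙ e -> s' ⊙ t' = b' ⊙ d' ->
  a ⊙ b ⊙ c = a' ⊙ b' ⊙ d -> d ⊙ e ⊙ f = d' ⊙ e' ⊙ f' ->
  a ⊙ (b ⊙ s) ⊙ (t ⊙ f) = (a' ⊙ s') ⊙ (t' ⊙ e') ⊙ f'.
Proof.
move=> st st' abc def.
transitivity (a ⊙ b ⊙ (s ⊙ t) ⊙ f); first by rewrite !cprodA.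
transitivity (a' ⊙ (s' ⊙ t') ⊙ e' ⊙ f'); last by rewrite !cprodA.
rewrite st st' !cprodA abc -!cprodA in def *.
by rewrite def.
Qed.
End Pasting.

(** * 2-cells into the pullback of composable pairs *)

Local Arguments pi21 {K pb G}.
Local Arguments pi22 {K pb G}.
Local Arguments pi31 {K pb G}.
Local Arguments pi32 {K pb G}.
Local Arguments pi33 {K pb G}.
Local Arguments one_mul {K pb G}.
Local Arguments mul_one {K pb G}.
Local Arguments unit_l {K pb G}.
Local Arguments unit_r {K pb G}.
Local Arguments pi3_12 {K pb G}.
Local Arguments pi3_23 {K pb G}.

Section Pairing.
Context {K : twocat} {pb : pullback_choice K} {G : pregraph pb} {X : K}.
Implicit Types u v w : twocell X (C2 G).

Lemma cell_ext2 u v :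
  pi21 ◃ u = pi21 ◃ v -> pi22 ◃ u = pi22 ◃ v -> u = v.
Proof. exact: pb_ext2. Qed.

(** Since projections are jointly monic on 1-cells as well, a factorization of
    both projections already forces the composability of [v] and [u]. *)
Lemma single_ext2 u v w :
  ⟦pi21 ◃ w⟧ = ⟦pi21 ◃ v⟧ ⊙ ⟦pi21 ◃ u⟧ -> ⟦pi22 ◃ w⟧ = ⟦pi22 ◃ v⟧ ⊙ ⟦pi22 ◃ u⟧ ->
  ⟦w⟧ = ⟦v⟧ ⊙ ⟦u⟧.
Proof.
move=> e1 e2; have [e1' _] := single_prod e1; have [e2' _] := single_prod e2.
have e : tgt u = src v by apply: ext2.
rewrite -(single_vc e); congr (single _).
by apply: cell_ext2; apply: single_inj; rewrite single_lw.
Qed.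
End Pairing.

(** * Extensionality of pseudo-functors and of natural transformations *)

Section Extensionality.
Context {K : twocat} {pb : pullback_choice K} {C D : pseudocategory pb}.
Implicit Types F G : pseudofunctor C D.

Lemma pseudofunctor_ext F G :
  F0 F = F0 G -> F1 F = F1 G -> of_cell (fmul F) = of_cell (fmul G) ->
  of_cell (funit F) = of_cell (funit G) -> F = G.
Proof.
case: F G => [[[f0 f1 d1 c1] m1 u1 im1 iu1 dm1 cm1 du1 cu1] a1 r1 l1].
case=> [[[g0 g1 d2 c2] m2 u2 im2 iu2 dm2 cm2 du2 cu2] a2 r2 l2] /= e0 e1.
subst g0 g1; case: _ / (proof_irrelevance _ d1 d2) m2 im2 dm2 cm2 a2 r2 l2.
case: _ / (proof_irrelevance _ c1 c2).
move=> m2 im2 dm2 cm2 a2 r2 l2 /of_cell_inj em /of_cell_inj eu.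
subst m2 u2.
case: _ / (proof_irrelevance _ im1 im2) a2 r2 l2.
case: _ / (proof_irrelevance _ iu1 iu2).
case: _ / (proof_irrelevance _ dm1 dm2).
case: _ / (proof_irrelevance _ cm1 cm2).
case: _ / (proof_irrelevance _ du1 du2).
case: _ / (proof_irrelevance _ cu1 cu2) => a2 r2 l2.
by rewrite (proof_irrelevance _ a1 a2) (proof_irrelevance _ r1 r2)
  (proof_irrelevance _ l1 l2).
Qed.

Lemma nattrans_ext F G (s t : nattrans F G) :
  nt0 s = nt0 t -> nt1 s = nt1 t -> s = t.
Proof.
case: s t => [s0 s1 ds cs ms us] [t0 t1 dt ct mt ut] /= e0 e1; subst t0 t1.
case: _ / (proof_irrelevance _ ds dt) mt.
case: _ / (proof_irrelevance _ cs ct) => mt.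
by rewrite (proof_irrelevance _ ms mt) (proof_irrelevance _ us ut).
Qed.

Lemma nattrans_arrow_ext F G F' G' (s : nattrans F G) (t : nattrans F' G') :
  F = F' -> G = G' -> of_cell (nt0 s) = of_cell (nt0 t) ->
  of_cell (nt1 s) = of_cell (nt1 t) -> Arrow s = Arrow t.
Proof.
move=> eF eG; subst F' G' => /of_cell_inj e0 /of_cell_inj e1.
by rewrite (nattrans_ext e0 e1).
Qed.
End Extensionality.

(** * The 1-cells induced by a pseudo-functor *)

Section Induced1cells.
Context {K : twocat} {pb : pullback_choice K}.

Section Prefunctor.
Context {C D : pseudocategory pb} (F : prefunctor C D).

Lemma pi21_F1_F1 : pi21 ∘ F1_F1 F = F1 F ∘ pi21.
Proof. exact: pi21_tup2. Qed.
Lemma pi22_F1_F1 : pi22 ∘ F1_F1 F = F1 F ∘ pi22.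
Proof. exact: pi22_tup2. Qed.
Lemma pi31_F1_F1_F1 : pi31 ∘ F1_F1_F1 F = F1 F ∘ pi31.
Proof. exact: pi31_tup3. Qed.
Lemma pi32_F1_F1_F1 : pi32 ∘ F1_F1_F1 F = F1 F ∘ pi32.
Proof. exact: pi32_tup3. Qed.
Lemma pi33_F1_F1_F1 : pi33 ∘ F1_F1_F1 F = F1 F ∘ pi33.
Proof. exact: pi33_tup3. Qed.

Lemma pi3_12_F1_F1_F1 : pi3_12 ∘ F1_F1_F1 F = F1_F1 F ∘ pi3_12.
Proof.
apply: ext2; rewrite !compA ?pi21_tup2 ?pi22_tup2 -compA.
  by rewrite pi21_tup2 pi31_tup3.
by rewrite pi22_tup2 pi32_tup3.
Qed.

Lemma pi3_23_F1_F1_F1 : pi3_23 ∘ F1_F1_F1 F = F1_F1 F ∘ pi3_23.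
Proof.
apply: ext2; rewrite !compA ?pi21_tup2 ?pi22_tup2 -compA.
  by rewrite pi21_tup2 pi32_tup3.
by rewrite pi22_tup2 pi33_tup3.
Qed.
End Prefunctor.

Section Prepseudofunctor.
Context {C D : pseudocategory pb} (F : prepseudofunctor C D).

(** The boundaries of the induced 2-cells, in the factored form in which
    [single_slide] applies to them. *)
Lemma src_one_fmul : src (one_fmul F) = F1_F1 F ∘ one_mul.
Proof.
rewrite src_ctup2; apply: ext2; rewrite compA ?pi21_tup2 ?pi22_tup2 -compA.
  by rewrite pi21_tup2.
by rewrite pi22_tup2 /= compA.
Qed.

Lemma tgt_one_fmul : tgt (one_fmul F) = one_mul ∘ F1_F1_F1 F.
Proof.
rewrite tgt_ctup2; apply: ext2; rewrite compA ?pi21_tup2 ?pi22_tup2 /=.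
  by rewrite pi31_tup3.
by rewrite -!compA pi3_23_F1_F1_F1.
Qed.

Lemma src_fmul_one : src (fmul_one F) = F1_F1 F ∘ mul_one.
Proof.
rewrite src_ctup2; apply: ext2; rewrite compA ?pi21_tup2 ?pi22_tup2 -compA.
  by rewrite pi21_tup2 /= compA.
by rewrite pi22_tup2.
Qed.

Lemma tgt_fmul_one : tgt (fmul_one F) = mul_one ∘ F1_F1_F1 F.
Proof.
rewrite tgt_ctup2; apply: ext2; rewrite compA ?pi21_tup2 ?pi22_tup2 /=.
  by rewrite -!compA pi3_12_F1_F1_F1.
by rewrite pi33_tup3.
Qed.

Lemma src_one_funit : src (one_funit F) = F1_F1 F ∘ unit_r.
Proof.
rewrite src_ctup2; apply: ext2; rewrite compA ?pi21_tup2 ?pi22_tup2 -compA.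
  by rewrite pi21_tup2 comp_oner.
by rewrite pi22_tup2 /= compA.
Qed.

Lemma tgt_one_funit : tgt (one_funit F) = unit_r ∘ F1 F.
Proof.
rewrite tgt_ctup2; apply: ext2; rewrite compA ?pi21_tup2 ?pi22_tup2 /=.
  by rewrite comp_onel.
by rewrite -!compA dom_F1.
Qed.

Lemma src_funit_one : src (funit_one F) = F1_F1 F ∘ unit_l.
Proof.
rewrite src_ctup2; apply: ext2; rewrite compA ?pi21_tup2 ?pi22_tup2 -compA.
  by rewrite pi21_tup2 /= compA.
by rewrite pi22_tup2 comp_oner.
Qed.

Lemma tgt_funit_one : tgt (funit_one F) = unit_l ∘ F1 F.
Proof.
rewrite tgt_ctup2; apply: ext2; rewrite compA ?pi21_tup2 ?pi22_tup2 /=.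
  by rewrite -!compA cod_F1.
by rewrite comp_onel.
Qed.
End Prepseudofunctor.
End Induced1cells.

(** * Composition of pseudo-functors *)

Section Composite.
Context {K : twocat} {pb : pullback_choice K} {C D E : pseudocategory pb}.
Variables (G : pseudofunctor D E) (F : pseudofunctor C D).

Definition comp_prefunctor : prefunctor C E.
Proof.
refine (@Prefunctor _ _ C E (F0 G ∘ F0 F) (F1 G ∘ F1 F) _ _).
  by rewrite dom_F1A dom_F1 compA.
by rewrite cod_F1A cod_F1 compA.
Defined.

Lemma F1_F1_comp : F1_F1 comp_prefunctor = F1_F1 G ∘ F1_F1 F.
Proof.
apply: ext2; rewrite compA.
  by rewrite !pi21_F1_F1 -(compA (F1 G)) pi21_F1_F1 compA.
by rewrite !pi22_F1_F1 -(compA (F1 G)) pi22_F1_F1 compA.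
Qed.

Lemma F1_F1_F1_comp : F1_F1_F1 comp_prefunctor = F1_F1_F1 G ∘ F1_F1_F1 F.
Proof.
apply: ext3; rewrite compA.
- by rewrite !pi31_F1_F1_F1 -(compA (F1 G)) pi31_F1_F1_F1 compA.
- by rewrite !pi32_F1_F1_F1 -(compA (F1 G)) pi32_F1_F1_F1 compA.
- by rewrite !pi33_F1_F1_F1 -(compA (F1 G)) pi33_F1_F1_F1 compA.
Qed.

Definition comp_fmul := (of_cell (fmul G) ▹ F1_F1 F)
  ·[comp_fmul_subproof G F] (F1 G ◃ of_cell (fmul F)).
Definition comp_funit := (of_cell (funit G) ▹ F0 F)
  ·[comp_funit_subproof G F] (F1 G ◃ of_cell (funit F)).

Lemma src_comp_fmul : src comp_fmul = F1 comp_prefunctor ∘ mul C.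
Proof. exact: compA. Qed.
Lemma tgt_comp_fmul : tgt comp_fmul = mul E ∘ F1_F1 comp_prefunctor.
Proof. by rewrite F1_F1_comp compA. Qed.
Lemma src_comp_funit : src comp_funit = F1 comp_prefunctor ∘ unit C.
Proof. exact: compA. Qed.
Lemma tgt_comp_funit : tgt comp_funit = unit E ∘ F0 comp_prefunctor.
Proof. by rewrite /= compA. Qed.

(** The structure 2-cells of G and the images under G of those of F both lie
    over identities, so their composites do too. *)
Definition comp_prepseudofunctor : prepseudofunctor C E.
Proof.
refine (@Prepseudofunctor _ _ C E comp_prefunctor
  (recell src_comp_fmul tgt_comp_fmul) (recell src_comp_funit tgt_comp_funit)
  _ _ _ _ _ _).
- by apply/recell_inv/vc_inv; [apply: lw_inv|apply: rw_inv]; exact: fmul_inv.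
- by apply/recell_inv/vc_inv; [apply: lw_inv|apply: rw_inv]; exact: funit_inv.
- apply: single_inj; rewrite recellK single_lw lw_lw dom_F1 -lw_lw dom_fmul.
  by rewrite hcA dom_fmul !hc_idc single_idl /= -!compA ?pi22_F1_F1 // dom_F1A.
- apply: single_inj; rewrite recellK single_lw lw_lw cod_F1 -lw_lw cod_fmul.
  by rewrite hcA cod_fmul !hc_idc single_idl /= -!compA ?pi21_F1_F1 // cod_F1A.
- apply: single_inj; rewrite recellK single_lw lw_lw dom_F1 -lw_lw dom_funit.
  by rewrite hcA dom_funit !hc_idc single_idl.
- apply: single_inj; rewrite recellK single_lw lw_lw cod_F1 -lw_lw cod_funit.
  by rewrite hcA cod_funit !hc_idc single_idl.
Defined.
Local Notation H := comp_prepseudofunctor.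

Lemma single_comp_fmul : ⟦of_cell (fmul H)⟧ =
  ⟦of_cell (fmul G) ▹ F1_F1 F⟧ ⊙ ⟦F1 G ◃ of_cell (fmul F)⟧.
Proof. by rewrite recellK single_vc. Qed.

Lemma single_comp_funit : ⟦of_cell (funit H)⟧ =
  ⟦of_cell (funit G) ▹ F0 F⟧ ⊙ ⟦F1 G ◃ of_cell (funit F)⟧.
Proof. by rewrite recellK single_vc. Qed.
End Composite.

Section CompositeCoherence.
Context {K : twocat} {pb : pullback_choice K} {C D E : pseudocategory pb}.
Variables (G : pseudofunctor D E) (F : pseudofunctor C D).
Local Notation H := (comp_prepseudofunctor G F).

(** The component with an identity is trivial; the other one is the defining
    decomposition of the multiplication 2-cell of GF, whiskered with a
    projection. *)
Lemma single_one_fmul_comp : ⟦one_fmul H⟧ =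
  ⟦one_fmul G ▹ F1_F1_F1 F⟧ ⊙ ⟦F1_F1 G ◃ one_fmul F⟧.
Proof.
apply: single_ext2; rewrite lw_rw lw_lw.
  rewrite pi21_F1_F1 -lw_lw !pi21_ctup2 !hc_idc.
  by rewrite -(compA (F1 G)) pi31_F1_F1_F1 single_idl /= compA.
rewrite pi22_F1_F1 -lw_lw !pi22_ctup2 rw_rw pi3_23_F1_F1_F1 -rw_rw lw_rw.
exact/single_rw_prod/single_comp_fmul.
Qed.

Lemma single_fmul_one_comp : ⟦fmul_one H⟧ =
  ⟦fmul_one G ▹ F1_F1_F1 F⟧ ⊙ ⟦F1_F1 G ◃ fmul_one F⟧.
Proof.
apply: single_ext2; rewrite lw_rw lw_lw.
  rewrite pi21_F1_F1 -lw_lw !pi21_ctup2 rw_rw pi3_12_F1_F1_F1 -rw_rw lw_rw.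
  exact/single_rw_prod/single_comp_fmul.
rewrite pi22_F1_F1 -lw_lw !pi22_ctup2 !hc_idc.
by rewrite -(compA (F1 G)) pi33_F1_F1_F1 single_idl /= compA.
Qed.

Lemma single_one_funit_comp : ⟦one_funit H⟧ =
  ⟦one_funit G ▹ F1 F⟧ ⊙ ⟦F1_F1 G ◃ one_funit F⟧.
Proof.
apply: single_ext2; rewrite lw_rw lw_lw.
  by rewrite pi21_F1_F1 -lw_lw !pi21_ctup2 !hc_idc single_idl.
rewrite pi22_F1_F1 -lw_lw !pi22_ctup2 rw_rw dom_F1 -rw_rw lw_rw.
exact/single_rw_prod/single_comp_funit.
Qed.

Lemma single_funit_one_comp : ⟦funit_one H⟧ =
  ⟦funit_one G ▹ F1 F⟧ ⊙ ⟦F1_F1 G ◃ funit_one F⟧.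
Proof.
apply: single_ext2; rewrite lw_rw lw_lw.
  rewrite pi21_F1_F1 -lw_lw !pi21_ctup2 rw_rw cod_F1 -rw_rw lw_rw.
  exact/single_rw_prod/single_comp_funit.
by rewrite pi22_F1_F1 -lw_lw !pi22_ctup2 !hc_idc single_idl.
Qed.

(** Naturality of the multiplication 2-cell of G with respect to [a].  In the
    applications [a] is one of the 2-cells 1 x mu, mu x 1, <1, epsilon d>,
    <epsilon c, 1> of F, [u] is the 1-cell of the source C at which the
    multiplication of F is evaluated, and [v] is its counterpart in D. *)
Lemma fmul_slide {X : K} (a : twocell X (C2 D)) (u : hom X (C2 C))
    {Y : K} (v : hom Y (C2 D)) (w : hom X Y) :
  src a = F1_F1 F ∘ u -> tgt a = v ∘ w ->
  ⟦mul E ◃ F1_F1 G ◃ a⟧ ⊙ ⟦of_cell (fmul G) ▹ F1_F1 F ▹ u⟧ =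
  ⟦of_cell (fmul G) ▹ v ▹ w⟧ ⊙ ⟦F1 G ◃ mul D ◃ a⟧.
Proof.
move=> es et; rewrite !lw_lw !rw_rw -es -et.
exact: (single_slide (of_cell (fmul G)) a).
Qed.

Lemma comp_fmul_assoc :
    (of_cell (assoc E) ▹ F1_F1_F1 H)
      ·[fassoc_subproof2 H] (mul E ◃ one_fmul H)
      ·[fassoc_subproof1 H] (of_cell (fmul H) ▹ one_mul)
    = (mul E ◃ fmul_one H)
      ·[fassoc_subproof4 H] (of_cell (fmul H) ▹ mul_one)
      ·[fassoc_subproof3 H] (F1 H ◃ of_cell (assoc C)).
Proof.
apply: single_inj; rewrite !single_vc F1_F1_F1_comp -rw_rw -lw_lw.
rewrite (single_lw_prod _ single_one_fmul_comp).
rewrite (single_lw_prod _ single_fmul_one_comp).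
rewrite !(single_rw_prod _ (single_comp_fmul G F)).
have := f_equal (fun x => ⟦x ▹ F1_F1_F1 F⟧) (fmul_assoc G).
have := f_equal (fun x => ⟦F1 G ◃ x⟧) (fmul_assoc F).
rewrite !single_lw !single_rw !lw_rw => eF eG.
apply: paste_assoc eG eF; apply: fmul_slide.
- exact: src_one_fmul.
- exact: tgt_one_fmul.
- exact: src_fmul_one.
- exact: tgt_fmul_one.
Qed.

Lemma comp_fmul_runit :
    F1 H ◃ of_cell (runit C)
    = (of_cell (runit E) ▹ F1 H)
      ·[frunit_subproof2 H] (mul E ◃ one_funit H)
      ·[frunit_subproof1 H] (of_cell (fmul H) ▹ unit_r).
Proof.
apply: single_inj; rewrite !single_vc -rw_rw -lw_lw.
rewrite (single_lw_prod _ single_one_funit_comp).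
rewrite (single_rw_prod _ (single_comp_fmul G F)).
have := f_equal (fun x => ⟦x ▹ F1 F⟧) (fmul_runit G).
have := f_equal (fun x => ⟦F1 G ◃ x⟧) (fmul_runit F).
rewrite !single_lw !single_rw !lw_rw => eF eG.
apply: paste_unit eG eF; apply: fmul_slide.
  exact: src_one_funit.
exact: tgt_one_funit.
Qed.

Lemma comp_fmul_lunit :
    F1 H ◃ of_cell (lunit C)
    = (of_cell (lunit E) ▹ F1 H)
      ·[flunit_subproof2 H] (mul E ◃ funit_one H)
      ·[flunit_subproof1 H] (of_cell (fmul H) ▹ unit_l).
Proof.
apply: single_inj; rewrite !single_vc -rw_rw -lw_lw.
rewrite (single_lw_prod _ single_funit_one_comp).
rewrite (single_rw_prod _ (single_comp_fmul G F)).
have := f_equal (fun x => ⟦x ▹ F1 F⟧) (fmul_lunit G).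
have := f_equal (fun x => ⟦F1 G ◃ x⟧) (fmul_lunit F).
rewrite !single_lw !single_rw !lw_rw => eF eG.
apply: paste_unit eG eF; apply: fmul_slide.
  exact: src_funit_one.
exact: tgt_funit_one.
Qed.

Definition comp_pseudofunctor : pseudofunctor C E :=
  Pseudofunctor comp_fmul_assoc comp_fmul_runit comp_fmul_lunit.

Lemma comp_pseudofunctorP : is_composite G F comp_pseudofunctor.
Proof. by split=> //; exact: recellK. Qed.
End CompositeCoherence.

(** * The identity pseudo-functor *)

Section Identity.
Context {K : twocat} {pb : pullback_choice K} (C : pseudocategory pb).

Definition id_prefunctor : prefunctor C C.
Proof.
refine (@Prefunctor _ _ C C (one (C0 C)) (one (C1 C)) _ _);
  by rewrite comp_onel comp_oner.
Defined.

Lemma F1_F1_id : F1_F1 id_prefunctor = one (C2 C).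
Proof.
by apply: ext2; rewrite ?pi21_F1_F1 ?pi22_F1_F1 comp_onel comp_oner.
Qed.

Lemma F1_F1_F1_id : F1_F1_F1 id_prefunctor = one (C3 C).
Proof.
by apply: ext3; rewrite ?pi31_F1_F1_F1 ?pi32_F1_F1_F1 ?pi33_F1_F1_F1
  comp_onel comp_oner.
Qed.

Lemma src_id_fmul : mul C = F1 id_prefunctor ∘ mul C.
Proof. by rewrite comp_onel. Qed.
Lemma tgt_id_fmul : mul C = mul C ∘ F1_F1 id_prefunctor.
Proof. by rewrite F1_F1_id comp_oner. Qed.
Lemma src_id_funit : unit C = F1 id_prefunctor ∘ unit C.
Proof. by rewrite comp_onel. Qed.
Lemma tgt_id_funit : unit C = unit C ∘ F0 id_prefunctor.
Proof. by rewrite comp_oner. Qed.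

Definition id_prepseudofunctor : prepseudofunctor C C.
Proof.
refine (@Prepseudofunctor _ _ C C id_prefunctor
  (@recell _ _ _ _ _ (idc (mul C)) src_id_fmul tgt_id_fmul)
  (@recell _ _ _ _ _ (idc (unit C)) src_id_funit tgt_id_funit) _ _ _ _ _ _).
- exact/recell_inv/idc_inv.
- exact/recell_inv/idc_inv.
- by rewrite recellK hc_idc dom_mul comp_onel.
- by rewrite recellK hc_idc cod_mul comp_onel.
- by rewrite recellK hc_idc dom_unit.
- by rewrite recellK hc_idc cod_unit.
Defined.
Local Notation I := id_prepseudofunctor.

Lemma fmul_id : of_cell (fmul I) = idc (mul C).
Proof. exact: recellK. Qed.
Lemma funit_id : of_cell (funit I) = idc (unit C).
Proof. exact: recellK. Qed.

Lemma one_fmul_id : one_fmul I = idc one_mul.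
Proof.
apply: cell_ext2; rewrite hc_idc ?pi21_ctup2 ?pi22_ctup2.
  by rewrite pi21_tup2 comp_onel.
by rewrite fmul_id hc_idc pi22_tup2.
Qed.

Lemma fmul_one_id : fmul_one I = idc mul_one.
Proof.
apply: cell_ext2; rewrite hc_idc ?pi21_ctup2 ?pi22_ctup2.
  by rewrite fmul_id hc_idc pi21_tup2.
by rewrite pi22_tup2 comp_onel.
Qed.

Lemma one_funit_id : one_funit I = idc unit_r.
Proof.
apply: cell_ext2; rewrite hc_idc ?pi21_ctup2 ?pi22_ctup2.
  by rewrite pi21_tup2.
by rewrite funit_id hc_idc pi22_tup2.
Qed.

Lemma funit_one_id : funit_one I = idc unit_l.
Proof.
apply: cell_ext2; rewrite hc_idc ?pi21_ctup2 ?pi22_ctup2.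
  by rewrite funit_id hc_idc pi21_tup2.
by rewrite pi22_tup2.
Qed.

Definition id_pseudofunctor : pseudofunctor C C.
Proof.
refine (@Pseudofunctor _ _ C C I _ _ _); apply: single_inj;
  rewrite !single_vc ?one_fmul_id ?fmul_one_id ?one_funit_id ?funit_one_id.
- by rewrite F1_F1_F1_id fmul_id rw_one lw_one !hc_idc !single_idl ?single_idr.
- by rewrite fmul_id rw_one lw_one !hc_idc !single_idr.
- by rewrite fmul_id rw_one lw_one !hc_idc !single_idr.
Defined.

Lemma id_pseudofunctorP : is_identity id_pseudofunctor.
Proof. by split=> //; exact: recellK. Qed.
End Identity.

(** * Strict associativity and unit laws *)

Section FunctorLaws.
Context {K : twocat} {pb : pullback_choice K}.

Lemma comp_pseudofunctorA {C D E E' : pseudocategory pb}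
    (H : pseudofunctor E E') (G : pseudofunctor D E) (F : pseudofunctor C D) :
  comp_pseudofunctor H (comp_pseudofunctor G F)
  = comp_pseudofunctor (comp_pseudofunctor H G) F.
Proof.
apply: pseudofunctor_ext; [exact: compA | exact: compA | |];
  apply: single_inj.
  rewrite !single_comp_fmul (single_lw_prod _ (single_comp_fmul G F)).
  rewrite (single_rw_prod _ (single_comp_fmul H G)) cprodA.
  by rewrite F1_F1_comp -rw_rw lw_lw lw_rw.
rewrite !single_comp_funit (single_lw_prod _ (single_comp_funit G F)).
rewrite (single_rw_prod _ (single_comp_funit H G)) cprodA.
by rewrite -rw_rw lw_lw lw_rw.
Qed.

Context {C D : pseudocategory pb} (F : pseudofunctor C D).

Lemma comp_pseudofunctor_idl : comp_pseudofunctor (id_pseudofunctor D) F = F.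
Proof.
apply: pseudofunctor_ext; [exact: comp_onel | exact: comp_onel | |];
  apply: single_inj.
  by rewrite single_comp_fmul fmul_id lw_one hc_idc single_idl.
by rewrite single_comp_funit funit_id lw_one hc_idc single_idl.
Qed.

Lemma comp_pseudofunctor_idr : comp_pseudofunctor F (id_pseudofunctor C) = F.
Proof.
apply: pseudofunctor_ext; [exact: comp_oner | exact: comp_oner | |];
  apply: single_inj.
  by rewrite single_comp_fmul fmul_id F1_F1_id rw_one hc_idc single_idr.
by rewrite single_comp_funit funit_id rw_one hc_idc single_idr.
Qed.
End FunctorLaws.

(** * Composition of natural transformations *)

Section Transformations.
Context {K : twocat} {pb : pullback_choice K}.
Local Notation nt2 t := (nt1_nt1 (dom_nt1 t) (cod_nt1 t)).

Lemma single_vcomp {A B : K} {f g h : hom A B} (b : cell g h) (a : cell f g) :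
  ⟦of_cell (vcomp (str K) b a)⟧ = ⟦of_cell b⟧ ⊙ ⟦of_cell a⟧.
Proof. exact: (@single_vc _ _ _ (of_cell b) (of_cell a) erefl). Qed.

Section Boundary.
Context {C D : pseudocategory pb} {F G : pseudofunctor C D} (t : nattrans F G).

Lemma src_nt2 : src (nt2 t) = F1_F1 F.
Proof. by rewrite src_ctup2; apply: ext2; rewrite ?pi21_tup2 ?pi22_tup2. Qed.
Lemma tgt_nt2 : tgt (nt2 t) = F1_F1 G.
Proof. by rewrite tgt_ctup2; apply: ext2; rewrite ?pi21_tup2 ?pi22_tup2. Qed.

Lemma single_nt_mul : ⟦of_cell (fmul G)⟧ ⊙ ⟦of_cell (nt1 t) ▹ mul C⟧ =
  ⟦mul D ◃ nt2 t⟧ ⊙ ⟦of_cell (fmul F)⟧.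
Proof. by have := f_equal single (nt_mul t); rewrite !single_vc. Qed.

Lemma single_nt_unit : ⟦of_cell (funit G)⟧ ⊙ ⟦of_cell (nt1 t) ▹ unit C⟧ =
  ⟦unit D ◃ of_cell (nt0 t)⟧ ⊙ ⟦of_cell (funit F)⟧.
Proof. by have := f_equal single (nt_unit t); rewrite !single_vc. Qed.
End Boundary.

Section IdentityTransformation.
Context {C D : pseudocategory pb} (F : pseudofunctor C D).

Lemma dom_id_nt1 : dom D ◃ idc (F1 F) = idc (F0 F) ▹ dom C.
Proof. by rewrite !hc_idc dom_F1. Qed.
Lemma cod_id_nt1 : cod D ◃ idc (F1 F) = idc (F0 F) ▹ cod C.
Proof. by rewrite !hc_idc cod_F1. Qed.

Lemma id_nt2 : nt1_nt1 dom_id_nt1 cod_id_nt1 = idc (F1_F1 F).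
Proof.
by apply: cell_ext2;
  rewrite ?pi21_ctup2 ?pi22_ctup2 !hc_idc ?pi21_F1_F1 ?pi22_F1_F1.
Qed.

Definition id_nattrans : nattrans F F.
Proof.
refine (@Nattrans _ _ C D F F _ _ dom_id_nt1 cod_id_nt1 _ _);
  apply: single_inj; rewrite !single_vc.
  by rewrite id_nt2 !hc_idc single_idl ?single_idr.
by rewrite !hc_idc single_idl ?single_idr.
Defined.
End IdentityTransformation.

Section Vertical.
Context {C D : pseudocategory pb} {F G H : pseudofunctor C D}.
Variables (t' : nattrans G H) (t : nattrans F G).

Lemma dom_vcomp_nt1 : dom D ◃ of_cell (vcomp (str K) (nt1 t') (nt1 t)) =
  of_cell (vcomp (str K) (nt0 t') (nt0 t)) ▹ dom C.
Proof.
apply: single_inj; rewrite (single_lw_prod _ (single_vcomp _ _)).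
by rewrite (single_rw_prod _ (single_vcomp _ _)) !dom_nt1.
Qed.

Lemma cod_vcomp_nt1 : cod D ◃ of_cell (vcomp (str K) (nt1 t') (nt1 t)) =
  of_cell (vcomp (str K) (nt0 t') (nt0 t)) ▹ cod C.
Proof.
apply: single_inj; rewrite (single_lw_prod _ (single_vcomp _ _)).
by rewrite (single_rw_prod _ (single_vcomp _ _)) !cod_nt1.
Qed.

Lemma single_vcomp_nt2 :
  ⟦nt1_nt1 dom_vcomp_nt1 cod_vcomp_nt1⟧ = ⟦nt2 t'⟧ ⊙ ⟦nt2 t⟧.
Proof.
by apply: single_ext2; rewrite ?pi21_ctup2 ?pi22_ctup2;
  exact/single_rw_prod/single_vcomp.
Qed.

(** The compatibility squares of [t] and [t'] are stacked on their common
    edge. *)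
Definition vcomp_nattrans : nattrans F H.
Proof.
refine (@Nattrans _ _ C D F H _ _ dom_vcomp_nt1 cod_vcomp_nt1 _ _);
  apply: single_inj; rewrite !single_vc (single_rw_prod _ (single_vcomp _ _)).
  rewrite cprodA single_nt_mul -cprodA single_nt_mul cprodA.
  by rewrite (single_lw_prod _ single_vcomp_nt2).
rewrite cprodA single_nt_unit -cprodA single_nt_unit cprodA.
by rewrite (single_lw_prod _ (single_vcomp _ _)).
Defined.
End Vertical.

Section Horizontal.
Context {C D E : pseudocategory pb}.
Context {F G : pseudofunctor C D} {F' G' : pseudofunctor D E}.
Variables (t' : nattrans F' G') (t : nattrans F G).
Local Notation t0 := (of_cell (nt0 t)).
Local Notation t1 := (of_cell (nt1 t)).
Local Notation t'0 := (of_cell (nt0 t')).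
Local Notation t'1 := (of_cell (nt1 t')).

Lemma dom_hcomp_nt1 : dom E ◃ (t'1 ⋆ t1) = (t'0 ⋆ t0) ▹ dom C.
Proof. by rewrite hcA dom_nt1 -!hcA dom_nt1. Qed.
Lemma cod_hcomp_nt1 : cod E ◃ (t'1 ⋆ t1) = (t'0 ⋆ t0) ▹ cod C.
Proof. by rewrite hcA cod_nt1 -!hcA cod_nt1. Qed.

Local Notation FF := (comp_pseudofunctor F' F).
Local Notation GG := (comp_pseudofunctor G' G).
Local Notation nt2h := (@nt1_nt1 _ _ _ _ FF GG
  (hcomp (str K) (nt0 t') (nt0 t)) (hcomp (str K) (nt1 t') (nt1 t))
  dom_hcomp_nt1 cod_hcomp_nt1).

(** On each projection both sides equal [t'1 ⋆ (t1 ▹ pi)], by associativity of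
    horizontal composition. *)
Lemma hcomp_nt2 : nt2h = nt2 t' ⋆ nt2 t.
Proof.
by apply: cell_ext2; rewrite [RHS]hcA ?pi21_ctup2 ?pi22_ctup2 -hcA
  ?pi21_ctup2 ?pi22_ctup2; symmetry; exact: (hcA t'1 t1).
Qed.

(** The square of [t] multiplied by [t'1] and the square of [t'] multiplied by
    [t1 x t1] (by [t0] for units) share the edge
    [t'1 ⋆ (m ◃ (t1 x t1)) = (t'1 ▹ m) ⋆ (t1 x t1)]. *)
Definition hcomp_nattrans : nattrans FF GG.
Proof.
refine (@Nattrans _ _ C E FF GG (hcomp (str K) (nt0 t') (nt0 t))
  (hcomp (str K) (nt1 t') (nt1 t)) dom_hcomp_nt1 cod_hcomp_nt1 _ _);
  apply: single_inj; rewrite !single_vc.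
  rewrite hcomp_nt2 !single_comp_fmul -cprodA.
  (* Displays the packed horizontal composite as ⋆, so that hcA applies. *)
  rewrite -[of_cell (hcomp _ (nt1 t') _)]/(t'1 ⋆ t1) -!hcA.
  have := hc_square_l t'1 (nt_mul t); have := hc_square_r (nt2 t) (nt_mul t').
  rewrite src_nt2 tgt_nt2 -!hcA /= => er ->.
  by rewrite !cprodA er.
rewrite !single_comp_funit -cprodA.
rewrite -[of_cell (hcomp _ (nt1 t') _)]/(t'1 ⋆ t1) -!hcA.
rewrite -[of_cell (hcomp _ (nt0 t') _)]/(t'0 ⋆ t0).
have := hc_square_l t'1 (nt_unit t); have := hc_square_r t0 (nt_unit t').
rewrite -!hcA /= => er ->.
by rewrite !cprodA er.
Defined.
End Horizontal.
End Transformations.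

(** * The 2-category of pseudo-categories *)

Definition pscat_structure (K : twocat) (pb : pullback_choice K) :
  twocat_structure (@nattrans K pb).
Proof.
refine (@TwoCatStructure (pseudocategory pb) (@pseudofunctor K pb) _
  (@id_pseudofunctor K pb) (fun C D E G F => comp_pseudofunctor G F)
  (@id_nattrans K pb) (fun C D F G H t' t => vcomp_nattrans t' t)
  (fun C D E F G F' G' t' t => hcomp_nattrans t' t) _ _ _ _ _ _ _ _ _ _ _).
- by move=> *; exact: comp_pseudofunctorA.
- by move=> *; exact: comp_pseudofunctor_idl.
- by move=> *; exact: comp_pseudofunctor_idr.
- by move=> *; apply: nattrans_ext; exact: vcompA.
- by move=> *; apply: nattrans_ext; exact: vcomp_idl.
- by move=> *; apply: nattrans_ext; exact: vcomp_idr.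
- by move=> *; apply: nattrans_ext; exact: hcomp_id2.
- by move=> *; apply: nattrans_ext; exact: interchange.
- move=> *; apply: nattrans_arrow_ext; try exact: comp_pseudofunctorA.
    exact: hcompA.
  exact: hcompA.
- move=> *; apply: nattrans_arrow_ext; try exact: comp_pseudofunctor_idl.
    exact: hcomp_idl.
  exact: hcomp_idl.
- move=> *; apply: nattrans_arrow_ext; try exact: comp_pseudofunctor_idr.
    exact: hcomp_idr.
  exact: hcomp_idr.
Defined.

Theorem theorem1 (K : twocat) (pb : pullback_choice K) :
  exists S : twocat_structure (@nattrans K pb),
    [/\ forall C : pseudocategory pb, is_identity (id1 S C),
        forall (C D E : pseudocategory pb)
          (G : pseudofunctor D E) (F : pseudofunctor C D),
          is_composite G F (comp1 S G F),
        forall (C D : pseudocategory pb) (F : pseudofunctor C D),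
          nt0 (id2 S F) = id2 (str K) (F0 F) /\
          nt1 (id2 S F) = id2 (str K) (F1 F),
        forall (C D : pseudocategory pb) (F G H : pseudofunctor C D)
          (t' : nattrans G H) (t : nattrans F G),
          nt0 (vcomp S t' t) = vcomp (str K) (nt0 t') (nt0 t) /\
          nt1 (vcomp S t' t) = vcomp (str K) (nt1 t') (nt1 t)
      & forall (C D E : pseudocategory pb)
          (F G : pseudofunctor C D) (F' G' : pseudofunctor D E)
          (t' : nattrans F' G') (t : nattrans F G),
          of_cell (nt0 (hcomp S t' t)) = of_cell (nt0 t') ⋆ of_cell (nt0 t) /\
          of_cell (nt1 (hcomp S t' t)) = of_cell (nt1 t') ⋆ of_cell (nt1 t)].
Proof.
exists (pscat_structure pb); split.
- exact: id_pseudofunctorP.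
- by move=> C D E G F; exact: comp_pseudofunctorP.
- by [].
- by [].
- by [].
Qed.
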